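(* Let $X$ be a continuum (a compact connected Hausdorff space, not necessarily metrizable). Then there exist a hereditarily indecomposable continuum $Y$ with $\dim Y = 1$ and weight equal to the weight of $X$, and a continuous surjection $f:Y\to X$ that is weakly confluent.
   Context: A compact Hausdorff space is called hereditarily indecomposable if whenever two subcontinua of it meet, one of them is contained in the other. A continuous surjection $f:Y\to X$ is weakly confluent if every subcontinuum of $X$ is the image under $f$ of some subcontinuum of $Y$. $\dim$ denotes covering dimension. *)

(* Defs.v *)
From HB Require Import structures.
From mathcomp Require Import all_boot all_order all_algebra.
From mathcomp Require Import all_classical all_reals all_analysis.
Set Implicit Arguments. Unset Strict Implicit. Unset Printing Implicit Defensive.
Local Open Scope classical_set_scope.
Local Open Scope card_scope.

Definition continuum (T : topologicalType) : Prop :=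
  [/\ hausdorff_space T, compact [set: T], connected [set: T] & [set: T] !=set0].

Definition subcontinuum (T : topologicalType) (K : set T) : Prop :=
  [/\ compact K, connected K & K !=set0].

Definition hereditarily_indecomposable (T : topologicalType) : Prop :=
  forall K L : set T, subcontinuum K -> subcontinuum L ->
    K `&` L !=set0 -> K `<=` L \/ L `<=` K.

Definition weakly_confluent (Y X : topologicalType) (f : Y -> X) : Prop :=
  [/\ continuous f, f @` [set: Y] = [set: X] &
      forall K : set X, subcontinuum K ->
        exists2 L : set Y, subcontinuum L & f @` L = K].

Definition covering_dim_le (T : topologicalType) (n : nat) : Prop :=
  forall s : seq (set T), (forall U, U \in s -> open U) ->
    (forall x : T, exists2 U, U \in s & U x) ->
    exists r : seq (set T),
      [/\ forall V, V \in r -> open V,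
          forall x : T, exists2 V, V \in r & V x,
          forall V, V \in r -> exists2 U, U \in s & V `<=` U &
          forall x : T, (count (fun V => `[< V x >]) r <= n.+1)%N].

Definition covering_dim_eq (T : topologicalType) (n : nat) : Prop :=
  covering_dim_le T n /\ forall m, (m < n)%N -> ~ covering_dim_le T m.

(* Weight (Engelking's convention: w(T) = aleph_0 + min card of a base).
   weight_le X Y  means  w(X) <= w(Y): some base of X has cardinality
   at most max(|B|, aleph_0) for every base B of Y (cardinals being
   totally ordered, <= max(a,b) iff <= a or <= b). *)
Definition weight_le (X Y : topologicalType) : Prop :=
  exists2 BX : set (set X), basis BX &
    forall BY : set (set Y), basis BY ->
      (BX #<= BY : Prop) \/ (BX #<= [set: nat] : Prop).

Definition same_weight (X Y : topologicalType) : Prop :=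
  weight_le X Y /\ weight_le Y X.

(* Main.v *)
(** Y is a closed subset of X * (nat -> R)^terms, where "terms" are
    formal names for the real functions needed on Y: Urysohn functions of a base
    of X, minima and affine images of earlier functions (so that the functions
    separate points from closed sets and give a small base of Y), and two kinds
    of new coordinates.
    - Krasinkiewicz-Minc folds: a coordinate r with (s, r) on a zigzag curve with
      three sheets over the range of an earlier function s. If two subcontinua
      meet and neither contains the other, a suitable fold tears one of them.
    - Skeleton coordinates: for a finite cover by {t_i > 1}, a point of a
      one-dimensional skeleton whose vertices are the allowed indices. This
      refines the cover by one of order two.
    Adding one coordinate amounts to replacing a continuum C by a subcontinuum M
    of a closed relation over C such that every subcontinuum of C is the image of
    one of M. For skeleton coordinates the fibres are connected and the full
    preimage works. For folds, the parity of the number of sheets lying in a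
    clopen piece of the preimage is locally constant, hence constant; pieces of
    odd parity surject on every subcontinuum of C, and compactness yields a
    component all of whose clopen neighbourhoods contain odd pieces.
    All the coordinates are obtained simultaneously as an ultralimit over the
    finite sets of terms. Starting from X * [0,1] keeps Y nondegenerate, and
    |seq A| <= max(|A|, aleph_0) controls the weight. *)
From HB Require Import structures.
From mathcomp Require Import all_boot all_order all_algebra.
From mathcomp Require Import all_classical all_reals all_analysis.
From mathcomp Require Import lra Rstruct.
Require Import Defs.
Set Implicit Arguments. Unset Strict Implicit. Unset Printing Implicit Defensive.
Import Order.TTheory GRing.Theory Num.Theory numFieldNormedType.Exports.
Local Open Scope classical_set_scope.
Local Open Scope card_scope.

(** * Cardinality of finite sequences *)

Lemma card_le_inj (T U : Type) (A : set T) (B : set U) (f : T -> U) :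
  (forall x, A x -> B (f x)) ->
  (forall x y, A x -> A y -> f x = f y -> x = y) -> A #<= B.
Proof.
move=> fAB finj.
have [g] : $|{injfun A >-> B}|.
  apply/injfunPex; exists f => // x y; rewrite !inE; exact: finj.
exact: inj_card_le.
Qed.

Lemma card_leTP (T U : Type) :
  [set: T] #<= [set: U] <-> exists f : T -> U, injective f.
Proof.
split=> [/card_leP[f]|[f finj]]; last first.
  by apply: (@card_le_inj _ _ _ _ f) => // x y _ _; exact: finj.
exists (fun x => val (f (SigSub (mem_set (I : [set: T] x))))) => x y /val_inj.
move=> fxy; have /= := @inj _ _ _ f _ _ _ _ fxy; rewrite !inE.
by move=> /(_ I I) [].
Qed.

Lemma card_set_typeP (T U : Type) (A : set T) (B : set U) :
  A #<= B <-> exists f : A -> B, injective f.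
Proof.
rewrite -card_leTP; split=> AB.
- apply: card_le_trans (card_le_trans AB _).
  + by have /card_eqPle[] := card_setT A.
  + by have /card_eqPle[] := card_setT B.
- apply: card_le_trans (card_le_trans AB _).
  + by have /card_eqPle[] := card_setT A.
  + by have /card_eqPle[] := card_setT B.
Qed.

(* A maximal family of choice functions with pairwise disjoint graphs must
   exhaust one of the sets, which therefore injects into all the others. *)
Lemma exists_min_card (I : Type) (T : I -> Type) (A : forall i, set (T i)) :
  inhabited I -> exists i, forall j, A i #<= A j.
Proof.
move=> [i0].
pose P (S : set (forall i, T i)) :=
  (forall f, S f -> forall i, A i (f i)) /\
  (forall f g i, S f -> S g -> f i = g i -> f = g).
have [F FP totF|S [[SA Sinj] Smax]] := @Zorn_bigcup _ P.
  split=> [f [X FX Xf]|f g i [X FX Xf] [Y FY Yg]]; first exact: (FP _ FX).1.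
  by have [XY|YX] := totF _ _ FX FY;
    [apply: (FP _ FY).2 => //; exact: XY|apply: (FP _ FX).2 => //; exact: YX].
have [i SAi] : exists i, A i `<=` (fun f => f i) @` S.
  apply: contrapT => /forallNP noi.
  have /(_ _)/cid-/all_sig[h hP] : forall i, exists a, A i a /\
      ~ ((fun f => f i) @` S) a.
    move=> i; have /existsNP[a /not_implyP[Aa nSa]] := noi i; by exists a.
  apply: (Smax (S `|` [set h])).
    split=> [x Sx|SU]; first by left.
    have Sh : S h by apply: SU; right.
    by apply: (hP i0).2; exists h.
  split=> [f [Sf|->] i|f g i]; [exact: SA|exact: (hP i).1|].
  move=> [Sf|->] [Sg|->] // fg; first exact: Sinj fg.
  - by case: (hP i).2; exists f.
  - by case: (hP i).2; exists g.
exists i => j; apply: card_le_trans (subset_card_le SAi) _.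
apply: card_le_trans (card_image_le _ _) _.
apply: (@card_le_inj _ _ _ _ (fun f => f j)) => [f /SA//|f g Sf Sg].
exact: Sinj.
Qed.

Lemma card_le_total (T U : Type) (A : set T) (B : set U) :
  A #<= B \/ B #<= A.
Proof.
pose V b := if b then T else U.
pose C (b : bool) : set (V b) := if b return set (V b) then A else B.
have [[] le] := @exists_min_card bool V C (inhabits true).
- by left; exact: (le false).
- by right; exact: (le true).
Qed.

(** Only nonempty sequences: otherwise the empty graph, which is the union of the empty chain in the
    Zorn argument below, would not be admissible. Membership goes through [nth] with every default,
    since [T] carries no decidable equality. *)
Definition seqs (T : Type) (B : set T) : set (seq T) :=
  [set s | s <> [::] /\ forall i x0, (i < size s)%N -> B (nth x0 s i)].

Lemma seqs_cons T (B : set T) x s :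
  B x -> (forall i x0, (i < size s)%N -> B (nth x0 s i)) -> seqs B (x :: s).
Proof. by move=> Bx Bs; split=> // -[|i] x0 //=; exact: Bs. Qed.

Lemma seqs1 T (B : set T) x : B x -> seqs B [:: x].
Proof. by move=> Bx; split=> // -[|i] x0. Qed.

Lemma seqs2 T (B : set T) x y : B x -> B y -> seqs B [:: x; y].
Proof. by move=> Bx By; split=> // -[|[|i]] x0. Qed.

Lemma seqs_map T U (B : set U) (f : T -> U) x s :
  (forall i x0, (i < size (x :: s))%N -> B (f (nth x0 (x :: s) i))) ->
  seqs B (map f (x :: s)).
Proof.
move=> fB; split=> // i x0; rewrite size_map => ilt.
rewrite (nth_map x) //; exact: fB.
Qed.

(* Zorn's lemma applied to injections of the nonempty sequences over a subset
   back into that subset. *)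
Lemma card_seq_infinite (T : Type) :
  [set: nat] #<= [set: T] -> [set: seq T] #<= [set: T].
Proof.
move=> /card_leTP[nT nTinj].
(* The subset whose sequences are injected into it is not a separate datum: it is read off the graph
   [G] as the elements whose singleton sequence has an image. *)
pose dom (G : set (seq T * T)) := [set x | exists y, G ([:: x], y)].
pose P (G : set (seq T * T)) :=
  [/\ forall s y y', G (s, y) -> G (s, y') -> y = y',
      forall s s' y, G (s, y) -> G (s', y) -> s = s',
      forall s y, G (s, y) -> seqs (dom G) s,
      forall s, seqs (dom G) s -> exists y, G (s, y) &
      forall s y, G (s, y) -> dom G y].
have dom_sub G G' : G `<=` G' -> dom G `<=` dom G'.
  by move=> GG' x [y Gy]; exists y; exact: GG'.
have seqs_sub B B' : B `<=` B' -> @seqs T B `<=` seqs B'.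
  by move=> BB' s [s0 Bs]; split=> // i x0 ilt; exact/BB'/Bs.
have [F FP totF|G [[Gfun Ginj Gdom Gtot Grng] Gmax]] := @Zorn_bigcup _ P.
  have two p q : (\bigcup_(X in F) X) p -> (\bigcup_(X in F) X) q ->
      exists X, [/\ F X, X p & X q].
    move=> [X FX Xp] [Y FY Yq]; have [XY|YX] := totF _ _ FX FY.
      by exists Y; split=> //; exact: XY.
    by exists X; split=> //; exact: YX.
  split=> [s y y' Fy Fy'|s s' y Fs Fs'|s y [X FX Xs]|s [s0 Bs]|s y [X FX Xs]].
  - by have [X [/FP[Xf _ _ _ _] Xy Xy']] := two _ _ Fy Fy'; exact: Xf Xy Xy'.
  - by have [X [/FP[_ Xf _ _ _] Xy Xy']] := two _ _ Fs Fs'; exact: Xf Xy Xy'.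
  - have [_ _ Xdom _ _] := FP _ FX.
    by apply: seqs_sub (Xdom _ _ Xs); apply: dom_sub; exact: bigcup_sup.
  (* A finite sequence over the union of the chain already lies over one of its members. *)
  - suff [X FX Xs] : exists2 X, F X & seqs (dom X) s.
      have [_ _ _ Xtot _] := FP _ FX.
      by have [y Xy] := Xtot _ Xs; exists y; exists X.
    case: s s0 Bs => // x s _; elim: s x => [|x' s IHs] x Bs.
      have [y [X FX Xy]] := Bs 0%N x isT.
      by exists X => //; apply: seqs_cons => //; exists y.
    have [|X FX [_ Xs]] := IHs x'; first by move=> i x0 ilt; exact: (Bs i.+1).
    have [y [Y FY Yy]] := Bs 0%N x isT.
    have [XY|YX] := totF _ _ FX FY.
      exists Y => //; apply: seqs_cons; first by exists y.
      by move=> i x0 ilt; apply: (dom_sub _ _ XY); exact: Xs.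
    exists X => //; apply: seqs_cons; last exact: Xs.
    by apply: (dom_sub _ _ YX); exists y.
  - have [_ _ _ _ Xrng] := FP _ FX.
    by apply: (dom_sub X); [exact: bigcup_sup|exact: Xrng Xs].
set B := dom G in Gdom Gtot Grng.
have [g gP] : exists g : seq T -> T, forall s, seqs B s -> G (s, g s).
  have /choice[g gP] : forall s, exists y, seqs B s -> G (s, y).
    move=> s; have [/Gtot[y Gy]|nB] := pselect (seqs B s); first by exists y.
    by exists (nT 0%N).
  by exists g.
have gB s : seqs B s -> B (g s) by move/gP/Grng.
have ginj s s' : seqs B s -> seqs B s' -> g s = g s' -> s = s'.
  by move=> /gP Gs /gP Gs' ss'; apply: Ginj Gs _; rewrite ss'.
(* How maximality is used: a nonempty [C] outside [B], with an injection [h] of the sequences over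
   the union into [C], would enlarge [G] by sending through [h] the sequences that are not over
   [B]. *)
have ext (C : set T) (h : seq T -> T) : C !=set0 -> C `<=` ~` B ->
    (forall s, seqs (B `|` C) s -> C (h s)) ->
    (forall s s', seqs (B `|` C) s -> seqs (B `|` C) s' -> h s = h s' ->
      s = s') -> False.
  move=> [c Cc] CB hC hinj.
  pose G' := G `|` [set p | [/\ seqs (B `|` C) p.1, ~ seqs B p.1 & p.2 = h p.1]].
  have domG' : dom G' = B `|` C.
    apply/seteqP; split=> [x [y [Gxy|[/= [_ /(_ 0%N x isT)//]]]]|x BCx].
      by left; exists y.
    have [Bx|nBx] := pselect (B x).
      by exists (g [:: x]); left; apply/gP/seqs1.
    exists (h [:: x]); right; split=> //=; first exact: seqs1.
    by move=> [_ /(_ 0%N x isT)].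
  apply: (Gmax G').
    split=> [p Gp|G'G]; first by left.
    apply: (CB _ Cc); apply: (dom_sub _ _ G'G); rewrite domG'; by right.
  have GC s y : G (s, y) -> C y -> False by move=> /Grng By /CB.
  split.
  - move=> s y y' [Gy|[/= BCs nBs ->]] [Gy'|[/= BCs' nBs' ->]] //.
    + exact: Gfun Gy Gy'.
    + by case: nBs'; exact: Gdom Gy.
    + by case: nBs; exact: Gdom Gy'.
  - move=> s s' y [Gy|[/= BCs nBs yE]] [Gy'|[/= BCs' nBs' yE']].
    + exact: Ginj Gy Gy'.
    + by case: (GC _ _ Gy); rewrite yE'; exact: hC.
    + by case: (GC _ _ Gy'); rewrite yE; exact: hC.
    + by apply: hinj => //; rewrite -yE -yE'.
  - rewrite domG' => s y [/Gdom|[]//]; apply: seqs_sub; exact: subsetUl.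
  - rewrite domG' => s BCs; have [Bs|nBs] := pselect (seqs B s).
      by exists (g s); left; exact: gP.
    by exists (h s); right.
  - rewrite domG' => s y [/Grng|[/= BCs _ ->]]; first by left.
    by right; exact: hC.
have [Bn0|B0] := pselect (B !=set0); last first.
  exfalso; have BN x : ~ B x by move=> Bx; apply: B0; exists x.
  have [nu nuinj] : exists nu : T -> nat,
      forall x y, range nT x -> range nT y -> nu x = nu y -> x = y.
    have /choice[nu nuP] : forall x, exists n, range nT x -> nT n = x.
      move=> x; have [[n _ nx]|nx] := pselect (range nT x); first by exists n.
      by exists 0%N.
    by exists nu => x y /nuP xE /nuP yE xy; rewrite -xE -yE xy.
  (* When [B] is empty, the copy of the natural numbers in [T] codes its own finite sequences. *)
  apply: (ext (range nT) (fun s => nT (choice.pickle (map nu s)))).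
  - by exists (nT 0%N); exists 0%N.
  - by move=> x _; exact: BN.
  - by move=> s _; exists (choice.pickle (map nu s)).
  - move=> s s' [_ Bs] [_ Bs'] /nTinj /(pcan_inj choice.pickleK) ss'.
    have szss : size s = size s' by have := congr1 size ss'; rewrite !size_map.
    apply: (@eq_from_nth _ (nT 0%N)) => // i ilt.
    have [/BN//|Bsi] := Bs i (nT 0%N) ilt.
    have [|/BN//|Bsi'] := Bs' i (nT 0%N); first by rewrite -szss.
    apply: nuinj => //; have := congr1 (fun t => nth 0%N t i) ss'.
    by rewrite !(nth_map (nT 0%N)) // -szss.
have [b0 [b1 [Bb0 Bb1 b01]]] : exists b0 b1, [/\ B b0, B b1 & b0 <> b1].
  have [b Bb] := Bn0.
  have B1 := seqs1 Bb; have B2 := seqs2 Bb Bb.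
  exists (g [:: b]), (g [:: b; b]); split; [exact: gB|exact: gB|].
  by move=> /ginj => /(_ B1 B2).
have [BC|CB] := card_le_total B (~` B).
- exfalso; have /card_set_typeP[j jinj] := BC.
  pose J b (Bb : B b) : T := val (j (SigSub (mem_set Bb))).
  have JB b Bb : ~ B (@J b Bb) by have := set_mem (valP (j (SigSub (mem_set Bb)))).
  have Jinj b b' Bb Bb' : @J b Bb = @J b' Bb' -> b = b'.
    by move=> /val_inj /jinj [].
  (* [C] is a copy of [B] in the complement. A sequence over the union is determined by two
     sequences over [B]: the underlying elements [bs] and the tags [kd]. The map [g] codes each of
     them, then the pair, and [J] moves the code into [C]. *)
  pose C := [set y | exists b, exists Bb : B b, y = J b Bb].
  have /choice[bs bsP] : forall y, exists b,
      (B y -> b = y) /\ (~ B y -> C y -> exists Bb : B b, y = J b Bb).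
    move=> y; have [By|nBy] := pselect (B y); first by exists y.
    have [[b [Bb yE]]|nCy] := pselect (C y); last by exists y.
    by exists b; split=> // _ _; exists Bb.
  pose kd y := if pselect (B y) then b0 else b1.
  have bsB y : (B `|` C) y -> B (bs y).
    move=> BCy; have [By|nBy] := pselect (B y); first by rewrite (bsP y).1.
    by case: BCy => // Cy; have [Bb _] := (bsP y).2 nBy Cy.
  have kdB y : B (kd y) by rewrite /kd; case: pselect.
  have bskd y y' : (B `|` C) y -> (B `|` C) y' -> bs y = bs y' ->
      kd y = kd y' -> y = y'.
    rewrite /kd; case: pselect => [By|nBy]; case: pselect => [By'|nBy'] //.
    - by rewrite (bsP y).1 // (bsP y').1.
    - by move=> _ _ _ /= /esym e; case: (b01 e).
    - move=> [//|Cy] [//|Cy'].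
      have [Bb yE] := (bsP y).2 nBy Cy; have [Bb' yE'] := (bsP y').2 nBy' Cy'.
      move=> bsE _; rewrite yE yE'; move: Bb Bb' {yE yE'}; rewrite bsE.
      by move=> Bb Bb'; congr J; exact: Prop_irrelevance.
  have Sbs s : seqs (B `|` C) s -> seqs B (map bs s).
    by case: s => [[]//|x s] [_ Bs]; apply: seqs_map => i x0 ilt; exact/bsB/Bs.
  have Skd s : seqs (B `|` C) s -> seqs B (map kd s).
    by case: s => [[]//|x s] [_ Bs]; apply: seqs_map => i x0 ilt; exact/kdB.
  have Sgg s : seqs (B `|` C) s -> seqs B [:: g (map bs s); g (map kd s)].
    by move=> Bs; apply: seqs2; [exact/gB/Sbs|exact/gB/Skd].
  have hB s : seqs (B `|` C) s -> B (g [:: g (map bs s); g (map kd s)]).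
    by move=> Bs; exact/gB/Sgg.
  pose h s := if pselect (B (g [:: g (map bs s); g (map kd s)])) is left Bb
    then J _ Bb else b0.
  apply: (ext C h).
  - by exists (J _ Bb0); exists b0, Bb0.
  - by move=> _ [b [Bb ->]]; exact: JB.
  - move=> s /hB Bs; rewrite /h; case: pselect => // Bb.
    by exists (g [:: g (map bs s); g (map kd s)]), Bb.
  - move=> s s' Bs Bs'; rewrite /h; case: pselect => [Bb|]; last by have := hB _ Bs.
    case: pselect => [Bb'|]; last by have := hB _ Bs'.
    move=> /Jinj /(ginj _ _ (Sgg _ Bs) (Sgg _ Bs')) [].
    move=> /(ginj _ _ (Sbs _ Bs) (Sbs _ Bs')) e1.
    move=> /(ginj _ _ (Skd _ Bs) (Skd _ Bs')) e2.
    have szss : size s = size s' by have := congr1 size e1; rewrite !size_map.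
    apply: (@eq_from_nth _ b0) => // i ilt.
    have ilt' : (i < size s')%N by rewrite -szss.
    apply: bskd; [exact: Bs.2|exact: Bs'.2| |].
    + by have := congr1 (fun t => nth b0 t i) e1; rewrite !(nth_map b0).
    + by have := congr1 (fun t => nth b0 t i) e2; rewrite !(nth_map b0).
(* Here the complement injects into [B], so tagging with [b0] or [b1] gives an injection [e] of all
   of [T] into [B]. The head [b0] added at the end makes the image of the empty sequence
   nonempty. *)
- have /card_set_typeP[j jinj] := CB.
  pose J y (nBy : (~` B) y) : T := val (j (SigSub (mem_set nBy))).
  pose e y : T := if pselect (B y) is right nBy
    then g [:: b1; @J y nBy] else g [:: b0; y].
  have jB y (nBy : (~` B) y) : B (J y nBy).
    exact: (set_mem (valP (j (SigSub (mem_set nBy))))).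
  have eB y : B (e y).
    by rewrite /e; case: pselect => [By|nBy]; apply/gB/seqs2 => //; exact: jB.
  have einj : injective e.
    move=> y y'; rewrite /e; case: pselect => [By|nBy]; case: pselect => [By'|nBy'].
    - by move=> /(ginj _ _ (seqs2 Bb0 By) (seqs2 Bb0 By')) [].
    - by move=> /(ginj _ _ (seqs2 Bb0 By) (seqs2 Bb1 (jB _ nBy'))) [b].
    - move=> /(ginj _ _ (seqs2 Bb1 (jB _ nBy)) (seqs2 Bb0 By')) [b].
      by case: (b01 (esym b)).
    - move=> /(ginj _ _ (seqs2 Bb1 (jB _ nBy)) (seqs2 Bb1 (jB _ nBy'))) [].
      by move=> /val_inj /jinj [].
  apply/card_leTP; exists (fun s => g (b0 :: map e s)) => s s'.
  have Sb s1 : seqs B (b0 :: map e s1).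
    apply: seqs_cons => // i x0; rewrite size_map => ilt.
    by case: s1 ilt => // x1 s1 ilt; rewrite (nth_map x1).
  by move=> /(ginj _ _ (Sb _) (Sb _)) [] /(inj_map einj).
Qed.

Lemma card_seq (T : Type) :
  [set: seq T] #<= [set: T] \/ [set: seq T] #<= [set: nat].
Proof.
have [cT|] := card_le_total [set: T] [set: nat]; last first.
  by move=> /card_seq_infinite; left.
right; apply/card_leTP; have /card_leTP[f finj] := cT.
exists (fun s => choice.pickle (map f s)) => s s' /(pcan_inj choice.pickleK).
exact: inj_map.
Qed.

Lemma card_le_seq (T U : Type) (f : U -> seq T) : injective f ->
  [set: U] #<= [set: T] \/ [set: U] #<= [set: nat].
Proof.
move=> finj; have UT : [set: U] #<= [set: seq T] by apply/card_leTP; exists f.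
by case: (card_seq T) => cT; [left|right]; exact: card_le_trans UT cT.
Qed.

(** * Continua and clopen pieces *)

Section Continua.
Context {T : topologicalType}.
Implicit Types (A B C D K : set T).

Lemma connected_split_open K A B : connected K -> open A -> open B ->
  K `<=` A `|` B -> (forall x, K x -> A x -> B x -> False) ->
  K `<=` A \/ K `<=` B.
Proof.
move=> cK oA oB KAB dAB.
have [[a [Ka Aa]]|nKA] := pselect (K `&` A !=set0).
  left; rewrite -[X in X `<=` _](cK (K `&` A)).
  - exact: subIsetr.
  - by exists a.
  - by exists A.
  - exists (~` B); first exact: open_closedC.
    apply/seteqP; split=> x [Kx] => [Ax|nBx]; split=> //.
      by move=> Bx; exact: (dAB x).
    by case: (KAB x Kx).
by right=> x Kx; case: (KAB x Kx) => // Ax; case: nKA; exists x.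
Qed.

Lemma connected_split_closed K A B : connected K -> closed A -> closed B ->
  K `<=` A `|` B -> (forall x, K x -> A x -> B x -> False) ->
  K `<=` A \/ K `<=` B.
Proof.
move=> cK cA cB KAB dAB.
have [||x Kx|x Kx|KB|KA] := @connected_split_open K (~` A) (~` B) cK.
- exact: closed_openC.
- exact: closed_openC.
- have [Ax|Bx] := KAB x Kx; [right=> Bx|left=> Ax]; exact: (dAB x).
- by have [Ax|Bx] := KAB x Kx => nAx nBx.
- by right=> x Kx; case: (KAB x Kx) => // Ax; case: (KB x Kx).
- by left=> x Kx; case: (KAB x Kx) => // Bx; case: (KA x Kx).
Qed.

Lemma closed_connectedP K : closed K ->
  (forall A B, closed A -> closed B -> K = A `|` B -> A `&` B = set0 ->
    A !=set0 -> B !=set0 -> False) ->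
  connected K.
Proof.
move=> clK nosplit; apply/connectedP => E [E0 KE [s1 s2]].
have Ecl b : closed (E b).
  rewrite closure_id; apply/seteqP; split; first exact: subset_closure.
  move=> x cEx; have : K x.
    by apply: clK; apply: closureS cEx; rewrite KE; case: b; [right|left].
  rewrite KE; case: b cEx => cEx [] // Ex.
  - by have : set0 x by rewrite -s2; split.
  - by have : set0 x by rewrite -s1; split.
apply: (nosplit _ _ (Ecl false) (Ecl true) KE) => //.
apply/seteqP; split=> // x [Efx Etx]; rewrite -s1; split=> //.
exact: subset_closure.
Qed.

Lemma connected_locally_const K (p : T -> bool) : connected K ->
  (forall z, K z -> \forall z' \near z, K z' -> p z' = p z) ->
  forall z z', K z -> K z' -> p z -> p z'.
Proof.
move=> cK lc z z' Kz Kz' pz.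
pose O (b : bool) := [set z | K z -> p z = b]°.
have OP b x : K x -> O b x <-> p x = b.
  move=> Kx; split=> [Ox|pxb]; first exact: (nbhs_singleton Ox).
  by move: (lc x Kx); rewrite pxb.
have [||x Kx|x Kx|KO|KO] := @connected_split_open K (O true) (O false) cK.
- exact: open_interior.
- exact: open_interior.
- by case px : (p x); [left|right]; apply/OP.
- by move=> /(OP true _ Kx) pt /(OP false _ Kx); rewrite pt.
- exact: ((OP true _ Kz').1 (KO _ Kz')).
- by move: pz; rewrite ((OP false _ Kz).1 (KO _ Kz)).
Qed.

Lemma compact_bigcap K (G : set (set T)) : compact K -> G !=set0 ->
  (forall A, G A -> closed A) ->
  (forall A B, G A -> G B -> exists2 C, G C & C `<=` A `&` B) ->
  (forall A, G A -> K `&` A !=set0) ->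
  exists2 x, K x & forall A, G A -> A x.
Proof.
move=> cK [A0 GA0] clG dirG KG.
have FF : ProperFilter (filter_from G (fun A => K `&` A)).
  apply: filter_from_proper; last exact: KG.
  apply: filter_from_filter; first by exists A0.
  move=> A B GA GB; have [C GC CAB] := dirG A B GA GB; exists C => // x [Kx Cx].
  by have [] := CAB x Cx.
have [|x [Kx clx]] := cK _ FF; first by exists A0.
exists x => // A GA; apply: clG => // N Nx.
have [|y [[_ Ay] Ny]] := clx (K `&` A) N _ Nx; first by exists A.
by exists y.
Qed.

Lemma compact_subcover (I : eqType) K (D : set I) (f : I -> set T) :
  compact K -> (forall i, D i -> open (f i)) ->
  (forall x, K x -> exists2 i, D i & f i x) ->
  exists s : seq I, (forall i, i \in s -> D i) /\
    forall x, K x -> exists2 i, i \in s & f i x.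
Proof.
move=> cK fo Kf; apply: contrapT => nos.
pose N (s : seq I) := [set x | forall i, i \in s -> ~ f i x].
have [||_ _ [s sD <-] [s' s'D <-]|_ [s sD <-]|x Kx xN] :=
  @compact_bigcap K [set N s | s in [set s : seq I | forall i : I, i \in s -> D i]] cK.
- by exists (N [::]); exists [::].
- move=> _ [s sD <-].
  rewrite (_ : N s = \bigcap_(i in [set` s]) ~` f i) //.
  by apply: closed_bigI => i /sD Di; apply: open_closedC; exact: fo.
- exists (N (s ++ s')).
    by exists (s ++ s') => // i; rewrite mem_cat => /orP[/sD|/s'D].
  by move=> x Nx; split=> i si; apply: Nx; rewrite mem_cat si ?orbT.
- apply: contrapT => /nonemptyPn KN; apply: nos; exists s; split=> // x Kx.
  apply: contrapT => nf; have : set0 x; last by [].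
  by rewrite -KN; split=> // i si fi; apply: nf; exists i.
- have [i Di fix_] := Kf x Kx.
  have : N [:: i] x by apply: xN; exists [:: i] => // k; rewrite inE => /eqP->.
  by move=> /(_ i); rewrite inE eqxx => /(_ isT).
Qed.

(** Compactness is used twice: if no separation exists, some [x] in [A] lies in the closure of every
    neighbourhood of [B], and then some [y] in [B] lies in the closure of every neighbourhood of
    [x]. The Hausdorff property gives [x = y]. *)
Lemma compact_separation A B : hausdorff_space T -> compact A -> compact B ->
  A `&` B = set0 ->
  exists O1 O2, [/\ open O1, open O2, A `<=` O1, B `<=` O2 & O1 `&` O2 = set0].
Proof.
move=> hT cA cB AB0; apply: contrapT => nsep.
have [||_ _ [N1 BN1 <-] [N2 BN2 <-]|_ [N BN <-]|x Ax xN] :=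
  @compact_bigcap A [set closure N | N in set_nbhs B] cA.
- by exists (closure setT); exists setT => //; exact: filterT.
- by move=> _ [N _ <-]; exact: closed_closure.
- exists (closure (N1 `&` N2)); last exact: closureI.
  by exists (N1 `&` N2) => //; exact: (@filterI _ (set_nbhs B)).
- apply: contrapT => /nonemptyPn AN; apply: nsep.
  have [W [oW BW WN]] := (set_nbhsP _ _).1 BN.
  exists (~` closure N), W; split=> //; first exact/closed_openC/closed_closure.
    exact/disjoints_subset.
  apply/seteqP; split=> // y [nNy /WN Ny]; exact/nNy/subset_closure.
have [||_ _ [N1 BN1 <-] [N2 BN2 <-]|_ [M xM <-]|y By yM] :=
  @compact_bigcap B [set closure M | M in nbhs x] cB.
- by exists (closure setT); exists setT => //; exact: filterT.
- by move=> _ [N _ <-]; exact: closed_closure.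
- exists (closure (N1 `&` N2)); last exact: closureI.
  by exists (N1 `&` N2) => //; exact: filterI.
- apply: contrapT => /nonemptyPn BM.
  have : closure (~` closure M) x.
    apply: xN; exists (~` closure M) => //; apply/set_nbhsP.
    exists (~` closure M); split=> //; first exact/closed_openC/closed_closure.
    exact/disjoints_subset.
  by move=> /(_ M xM) [z [nMz Mz]]; exact/nMz/subset_closure.
have xy : x = y.
  by apply: hT => M N xM yN; apply: (yM (closure M)) => //; exists M.
by have : set0 x by rewrite -AB0; split=> //; rewrite xy.
Qed.

(** A clopen subset of the subspace [D], expressed by closed sets of the ambient space. *)
Definition piece D A := [/\ A `<=` D, closed A & closed (D `\` A)].

Lemma piece_set0 D : closed D -> piece D set0.
Proof. by move=> clD; split=> //; [exact: closed0|rewrite setD0]. Qed.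

Lemma piece_refl D : closed D -> piece D D.
Proof. by move=> clD; split=> //; rewrite setDv; exact: closed0. Qed.

Lemma pieceU D A B : piece D A -> piece D B -> piece D (A `|` B).
Proof.
move=> [AD clA clDA] [BD clB clDB]; split; first by rewrite subUset.
  exact: closedU.
by rewrite setDUr; exact: closedI.
Qed.

Lemma pieceD D A : piece D A -> piece D (D `\` A).
Proof.
by move=> [AD clA clDA]; split=> //; rewrite setDD setIidr.
Qed.

Lemma pieceI D A B : piece D A -> piece D B -> piece D (A `&` B).
Proof.
move=> [AD clA clDA] [BD clB clDB]; split; first by move=> x [/AD].
  exact: closedI.
by rewrite setDIr; exact: closedU.
Qed.

Lemma piece_trans D A B : piece D A -> piece A B -> piece D B.
Proof.
move=> [AD clA clDA] [BA clB clAB]; split=> //; first exact: subset_trans AD.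
have -> : D `\` B = (D `\` A) `|` (A `\` B).
  apply/seteqP; split=> x [].
  - by move=> Dx nBx; have [Ax|nAx] := pselect (A x); [right|left].
  - by move=> [Dx nAx]; split=> // /BA.
  - by move=> [/AD Dx nBx].
exact: closedU.
Qed.

Lemma piece_restrict D D' A : closed D' -> D' `<=` D -> piece D A ->
  piece D' (A `&` D').
Proof.
move=> clD' D'D [AD clA clDA]; split; [exact: subIsetr|exact: closedI|].
have -> : D' `\` (A `&` D') = (D `\` A) `&` D'.
  apply/seteqP; split=> x.
  - by move=> [D'x nA]; split=> //; split; [exact: D'D|move=> Ax; exact: nA].
  - by move=> [[Dx nAx] D'x]; split=> // -[].
exact: closedI.
Qed.

(** The complements in [D] of the small pieces form a directed family of closed sets, none of them
    empty because [D] is not small; any common point serves as [e]. *)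
Lemma piece_not_small D (small : set T -> Prop) : closed D -> compact D ->
  small set0 ->
  (forall A B, piece D A -> piece D B -> small A -> small B -> small (A `|` B)) ->
  ~ small D ->
  exists2 e, D e & forall A, piece D A -> A e -> ~ small A.
Proof.
move=> clD cD small0 smallU nsD.
have [|_ [B [pB sB] <-]|_ _ [A' [pA sA] <-] [B' [pB sB] <-]|_ [B [pB sB] <-]|e De eP] :=
  @compact_bigcap D [set D `\` A | A in [set A | piece D A /\ small A]] cD.
- by exists (D `\` set0); exists set0 => //; split=> //; exact: piece_set0.
- by case: pB.
- exists (D `\` (A' `|` B')); last by rewrite setDUr.
  by exists (A' `|` B') => //; split; [exact: pieceU|exact: smallU].
- apply: contrapT => /nonemptyPn DB; apply: nsD; suff -> : D = B by [].
  have [BD _ _] := pB; apply/seteqP; split=> // x Dx.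
  by apply: contrapT => nBx; have : set0 x by rewrite -DB; split.
- exists e => // A pA Ae sA; have [//] : (D `\` A) e.
  by apply: eP; exists A.
Qed.

Definition quasi_component D e := [set x | forall A, piece D A -> A e -> A x].

Lemma quasi_component_sub D e : closed D -> D e -> quasi_component D e `<=` D.
Proof. by move=> clD De x; apply=> //; exact: piece_refl. Qed.

Lemma quasi_component_closed D e : closed (quasi_component D e).
Proof.
move=> x clx A pA Ae; have [_ clA _] := pA; apply: clA => N /clx [y [qy Ny]].
by exists y; split=> //; exact: qy.
Qed.

Lemma quasi_component_meet D e F : closed D -> compact D -> D e -> closed F ->
  (forall A, piece D A -> A e -> A `&` F !=set0) ->
  quasi_component D e `&` F !=set0.
Proof.
move=> clD cD De clF AF.
have [|_ [B [pB Be] <-]|_ _ [A' [pA Ae] <-] [B' [pB Be] <-]|_ [B [pB Be] <-]|x Dx xP] :=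
  @compact_bigcap D [set A `&` F | A in [set A | piece D A /\ A e]] cD.
- by exists (D `&` F); exists D => //; split=> //; exact: piece_refl.
- by case: pB => _ clB _; exact: closedI.
- exists (A' `&` B' `&` F); last by move=> x [[? ?] ?].
  by exists (A' `&` B') => //; split=> //; exact: pieceI.
- have [x [Bx Fx]] := AF _ pB Be; exists x; split=> //.
  by case: pB => BD _ _; exact: BD.
- exists x; split=> [A pA Ae|].
  + by have [] : (A `&` F) x by apply: xP; exists A.
  + have [//] : (D `&` F) x.
    by apply: xP; exists D => //; split=> //; exact: piece_refl.
Qed.

(** Suppose the quasi-component splits into closed [A] and [B] with [e] in [A], separated by open
    [U1] and [U2]. By compactness a piece [C] around [e] lies in the union of [U1] and [U2]. Its
    trace on [U1] is again a piece around [e], but it misses [B]. *)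
Lemma quasi_component_subcontinuum D e : hausdorff_space T -> compact D -> D e ->
  subcontinuum (quasi_component D e).
Proof.
move=> hT cD De; have clD := compact_closed hT cD.
have cQ : compact (quasi_component D e).
  apply: subclosed_compact cD _; first exact: quasi_component_closed.
  exact: quasi_component_sub.
split=> //; last by exists e => A.
apply: closed_connectedP; first exact: quasi_component_closed.
move=> A B; wlog Ae : A B / A e.
  move=> wl clA clB QAB AB0 nA nB; have : quasi_component D e e by move=> C.
  rewrite QAB => -[Ae|Be]; first exact: (wl A B).
  by apply: (wl B A) => //; [rewrite QAB setUC|rewrite setIC].
move=> clA clB QAB AB0 nA [b Bb].
have QD := quasi_component_sub clD De.
have [AD BD] : A `<=` D /\ B `<=` D by rewrite -subUset -QAB.
have cA := subclosed_compact clA cD AD; have cB := subclosed_compact clB cD BD.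
have [U1 [U2 [oU1 oU2 AU1 BU2 U120]]] := compact_separation hT cA cB AB0.
have [||x [qx nU]] := @quasi_component_meet D e (~` (U1 `|` U2)) clD cD De.
- by apply: open_closedC; exact: openU.
- move=> C pC Ce; apply: contrapT => /nonemptyPn CO.
  have CU12 x : C x -> U1 x \/ U2 x.
    by move=> Cx; apply: contrapT => nO; have : set0 x by rewrite -CO.
  have [CD clC clDC] := pC.
  have pCU1 : piece D (C `&` U1).
    have CE : C `&` U1 = C `&` ~` U2.
      apply/seteqP; split=> x [Cx Ox]; split=> //.
      - by move=> U2x; have : set0 x by rewrite -U120.
      - by case: (CU12 x Cx).
    split; first by move=> x [/CD].
      by rewrite CE; apply: closedI => //; exact: open_closedC.
    rewrite setDIr; apply: closedU => //.
    by rewrite setDE; apply: closedI => //; exact: open_closedC.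
  have [||_ U1b] := (_ : quasi_component D e b) _ pCU1; first by rewrite QAB; right.
    by split=> //; exact: AU1.
  by have : set0 b by rewrite -U120; split=> //; exact: BU2.
- by apply: nU; move: qx; rewrite QAB => -[/AU1|/BU2]; [left|right].
Qed.

End Continua.

(** * Ultralimits of continua *)

Lemma subcontinuum_image (T U : topologicalType) (f : T -> U) (K : set T) :
  continuous f -> subcontinuum K -> subcontinuum (f @` K).
Proof.
move=> cf [cK coK [x Kx]]; split.
- by apply: continuous_compact => //; exact: continuous_subspaceT.
- by apply: connected_continuous_connected => //; exact: continuous_subspaceT.
- by exists (f x); exists x.
Qed.

Lemma subcontinuum1 (T : topologicalType) (x : T) : subcontinuum [set x].
Proof.
by split; [exact: compact_set1|exact: connected1|exists x].
Qed.

Section Ultralimit.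
Context {I : Type} (F : set_system I) {FU : UltraFilter F} {T : topologicalType}.
Implicit Type L : I -> set T.

(** The Kuratowski limit of the sets [L i] along [F]; for an ultrafilter the lower and upper limits
    agree. *)
Definition ultralimit L : set T :=
  [set x | forall N, nbhs x N -> F [set i | L i `&` N !=set0]].

Lemma ultralimit_closed L : closed (ultralimit L).
Proof.
move=> x clx N Nx; have [y [Ly /= Ny]] := clx _ (nbhs_interior Nx).
exact: Ly.
Qed.

Lemma ultralimit_sub L S : closed S -> F [set i | L i `<=` S] ->
  ultralimit L `<=` S.
Proof.
move=> clS FS x Lx; apply: clS => N Nx; apply: contrapT => SN.
have : F set0.
  apply: filterS (filterI FS (Lx N Nx)) => i [LiS [y [Ly Ny]]].
  by apply: SN; exists y; split=> //; exact: LiS.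
exact: filter_not_empty.
Qed.

Lemma ultralimit_mono L L' : (forall i, L i `<=` L' i) ->
  ultralimit L `<=` ultralimit L'.
Proof.
move=> LL' x Lx N Nx; apply: filterS (Lx N Nx) => i [y [Ly Ny]].
by exists y; split=> //; exact: LL'.
Qed.

(** Each point of [K] outside [S] has a neighbourhood that [F]-almost all [L i] miss; compactness of
    [K] minus [S] makes this uniform. *)
Lemma ultralimit_near L K S : compact K -> (forall i, L i `<=` K) -> open S ->
  ultralimit L `<=` S -> F [set i | L i `<=` S].
Proof.
move=> cK LK oS LS.
have cKS : compact (K `\` S) by apply: compact_closedI => //; exact: open_closedC.
have : \near F, K `\` S `<=` (fun i x => ~ L i x) F.
  move/compact_near_coveringP : cKS; apply => x [Kx nSx].
  have [N [Nx FN]] : exists N, nbhs x N /\ ~ F [set i | L i `&` N !=set0].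
    apply: contrapT => nN; apply/nSx/LS => N Nx.
    by apply: contrapT => FN; apply: nN; exists N.
  have [//|FnN] := in_ultra_setVsetC [set i | L i `&` N !=set0] FU.
  exists (N, ~` [set i | L i `&` N !=set0]) => // -[y i] [/= Ny nLN] Ly.
  by apply: nLN; exists y.
apply: filterS => i /= KSL x Lx; apply: contrapT => nSx.
by apply: (KSL x) => //; split=> //; exact: (LK i).
Qed.

Lemma ultralimit_nonempty L K : compact K -> (forall i, L i `<=` K) ->
  (forall i, L i !=set0) -> ultralimit L !=set0.
Proof.
move=> cK LK L0; apply: contrapT => /nonemptyPn UL0.
have := @ultralimit_near L K set0 cK LK open0; rewrite UL0 => /(_ (@subset_refl _ _)).
move=> FL; apply: (@filter_not_empty _ F); apply: filterS FL => i Li0.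
by have [x /Li0] := L0 i.
Qed.

(** If the limit splits between disjoint open [U] and [V], then almost every [L i] lies in their
    union, hence in one of them. The ultrafilter decides which one for almost all [i], and the other
    contains no limit point. *)
Lemma ultralimit_subcontinuum L K : hausdorff_space T -> compact K ->
  (forall i, L i `<=` K) -> (forall i, subcontinuum (L i)) ->
  subcontinuum (ultralimit L).
Proof.
move=> hT cK LK sL; have clK := compact_closed hT cK.
have ULK : ultralimit L `<=` K.
  by apply: ultralimit_sub => //; apply: filterS filterT => i _; exact: LK.
split; [exact: subclosed_compact (@ultralimit_closed L) cK ULK| |]; last first.
  by apply: ultralimit_nonempty cK LK _ => i; case: (sL i).
apply: closed_connectedP; first exact: ultralimit_closed.
move=> A B clA clB LAB AB0 [a Aa] [b Bb].
have [AK BK] : A `<=` K /\ B `<=` K by rewrite -subUset -LAB.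
have cA := subclosed_compact clA cK AK; have cB := subclosed_compact clB cK BK.
have [U [V [oU oV AU BV UV0]]] := compact_separation hT cA cB AB0.
have disj (C : I -> Prop) W x : F C -> open W -> W x -> ultralimit L x ->
    (forall i, C i -> L i `&` W = set0) -> False.
  move=> FC oW Wx Lx CW; apply: (@filter_not_empty _ F).
  apply: filterS (filterI FC (Lx _ (open_nbhs_nbhs (conj oW Wx)))).
  by move=> i [/CW LW]; rewrite /= LW => -[].
have FUV : F [set i | L i `<=` U `|` V].
  apply: ultralimit_near cK LK (openU oU oV) _; rewrite LAB.
  by move=> x [/AU|/BV]; [left|right].
have [FLU|FnLU] := in_ultra_setVsetC [set i | L i `<=` U] FU.
- apply: (disj _ V b FLU oV (BV _ Bb)); first by rewrite LAB; right.
  move=> i LiU; apply/seteqP; split=> // x [/LiU Ux Vx]; by rewrite -UV0.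
- apply: (disj _ U a (filterI FUV FnLU) oU (AU _ Aa)); first by rewrite LAB; left.
  move=> i [LiUV /= nLiU]; have [_ coL _] := sL i.
  have [|//|LiV] := connected_split_open coL oU oV LiUV.
    by move=> x _ Ux Vx; have : set0 x by rewrite -UV0.
  by apply/seteqP; split=> // x [/LiV Vx Ux]; rewrite -UV0.
Qed.

Lemma ultralimit_image (T' : topologicalType) (f : T -> T') L K S :
  hausdorff_space T' -> continuous f -> compact K -> (forall i, L i `<=` K) ->
  closed S -> (forall i, f @` L i = S) -> f @` ultralimit L = S.
Proof.
move=> hT' cf cK LK clS fLS; apply/seteqP; split=> [_ [x Lx <-]|y Sy].
  suff : ultralimit L `<=` f @^-1` S by exact.
  apply: ultralimit_sub; first by apply: preimage_closed => // ? ?; exact: cf.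
  by apply: filterS filterT => i _ z Lz; rewrite -(fLS i); exists z.
apply: contrapT => nLy; pose W := f @^-1` (~` [set y]).
have oW : open W.
  apply: open_comp; first by move=> ? ?; exact: cf.
  exact/closed_openC/accessible_closed_set1/hausdorff_accessible.
have : F [set i | L i `<=` W].
  by apply: ultralimit_near cK LK oW _ => x Lx fxy; apply: nLy; exists x.
move=> FW; apply: (@filter_not_empty _ F); apply: filterS FW => i LiW.
by have [x Lx fxy] : (f @` L i) y; [rewrite fLS|exact: (LiW x Lx)].
Qed.

End Ultralimit.

(** * Lifting subcontinua to closed relations *)

Lemma fst_continuous (T U : topologicalType) : continuous (@fst T U).
Proof. by move=> p; exact: cvg_fst. Qed.

Lemma snd_continuous (T U : topologicalType) : continuous (@snd T U).
Proof. by move=> p; exact: cvg_snd. Qed.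

Lemma pair_continuous (T U V : topologicalType) (f : T -> U) (g : T -> V) :
  continuous f -> continuous g -> continuous (fun x => (f x, g x)).
Proof. by move=> cf cg x; apply: cvg_pair; [exact: cf|exact: cg]. Qed.

Lemma cluster_nbhs_image (T U : topologicalType) (f : T -> U) (p q : T) :
  continuous f -> cluster (nbhs p) q -> cluster (nbhs (f p)) (f q).
Proof.
move=> cf clpq M N fpM fqN.
have [x [Mx Nx]] := clpq _ _ (cf p M fpM) (cf q N fqN).
by exists (f x).
Qed.

Lemma hausdorff_pair (T U : topologicalType) :
  hausdorff_space T -> hausdorff_space U -> hausdorff_space (T * U)%type.
Proof.
move=> hT hU [p1 p2] [q1 q2] clpq; congr (_, _).
- by apply: hT; exact: (cluster_nbhs_image (@fst_continuous T U) clpq).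
- by apply: hU; exact: (cluster_nbhs_image (@snd_continuous T U) clpq).
Qed.

Lemma closed_preimage (T U : topologicalType) (f : T -> U) (D : set U) :
  continuous f -> closed D -> closed (f @^-1` D).
Proof. by move=> cf; apply: preimage_closed => x _; exact: cf. Qed.

Lemma open_preimage (T U : topologicalType) (f : T -> U) (D : set U) :
  continuous f -> open D -> open (f @^-1` D).
Proof. by move=> cf; apply: open_comp => x _; exact: cf. Qed.

Lemma closed_graph (T V : topologicalType) (h : T -> V) : hausdorff_space V ->
  continuous h -> closed [set p : T * V | p.2 = h p.1].
Proof.
move=> hV ch [z v] clzv; apply/esym/hV => M N hM vN.
have [|[z' v'] [/= v'E [Mz Nv]]] := clzv ((h @^-1` M) `*` N).
  by exists (h @^-1` M, N) => //; split=> //; exact: ch.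
by exists v'; split=> //; rewrite v'E.
Qed.

Section Liftable.
Context {T V : topologicalType} (hT : hausdorff_space T) (hV : hausdorff_space V).

(** What is needed to add one coordinate with values in [box]. A single [M] serves all subcontinua
    [K] of [C]; that [M] projects onto [C] is the case [K = C]. *)
Definition liftable (box : set V) (R : set (T * V)) :=
  forall C : set T, subcontinuum C ->
  exists M : set (T * V), [/\ subcontinuum M, M `<=` R `&` (C `*` box) &
    forall K, subcontinuum K -> K `<=` C ->
      exists L, [/\ subcontinuum L, L `<=` M & fst @` L = K]].

Lemma liftable_sub box R R' : R `<=` R' -> liftable box R -> liftable box R'.
Proof.
move=> RR' lR C sC; have [M [sM MR lM]] := lR C sC; exists M; split=> //.
by move=> p /MR[Rp Cp]; split=> //; exact: RR'.
Qed.

Let hTV : hausdorff_space (T * V)%type := hausdorff_pair hT hV.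

(** Each fibre is connected, so it stays on one side of a splitting into closed sets; the two sides
    then project to disjoint closed sets covering [K]. *)
Lemma monotone_subcontinuum (box : set V) (R : set (T * V)) (K : set T) :
  compact box -> closed R ->
  (forall z, [set v | R (z, v) /\ box v] !=set0) ->
  (forall z, connected [set v | R (z, v) /\ box v]) ->
  subcontinuum K ->
  subcontinuum (R `&` (K `*` box)) /\ fst @` (R `&` (K `*` box)) = K.
Proof.
move=> cbox clR Rn0 Rcon.
move=> [cK coK [x Kx]].
have cE : compact (R `&` (K `*` box)).
  by rewrite setIC; apply: compact_closedI => //; exact: compact_setX.
have imE : fst @` (R `&` (K `*` box)) = K.
  apply/seteqP; split=> [_ [p [_ [Kp _]] <-]//|z Kz].
  by have [v [Rv bv]] := Rn0 z; exists (z, v).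
split=> //; split=> //; last first.
  by have [v [Rv bv]] := Rn0 x; exists (x, v).
apply: closed_connectedP; first exact: compact_closed.
move=> A B clA clB EAB AB0 [a Aa] [b Bb].
have [AE BE] : A `<=` R `&` (K `*` box) /\ B `<=` R `&` (K `*` box).
  by rewrite -subUset -EAB.
have clf (D : set (T * V)) : closed D -> D `<=` R `&` (K `*` box) ->
    closed (fst @` D).
  move=> clD DE; apply: compact_closed => //; apply: continuous_compact.
    by apply: continuous_subspaceT; exact: fst_continuous.
  exact: subclosed_compact clD cE DE.
have fibre z v w : A (z, v) -> B (z, w) -> False.
  move=> Azv Bzw.
  have cz : continuous (fun v : V => (z, v)).
    by apply: pair_continuous => u; [exact: cvg_cst|exact: cvg_id].
  have [||||FA|FB] := @connected_split_closed _ _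
    [set v | A (z, v)] [set v | B (z, v)] (Rcon z).
  - by apply: preimage_closed clA => // ? ?; exact: cz.
  - by apply: preimage_closed clB => // ? ?; exact: cz.
  - move=> u [Ru bu]; have : (R `&` (K `*` box)) (z, u).
      by split=> //; split=> //; have [_ []] := AE _ Azv.
    by rewrite EAB.
  - by move=> u _ Au Bu; have : set0 (z, u) by rewrite -AB0.
  - have [Rw [_ bw]] := BE _ Bzw; have : set0 (z, w).
      by rewrite -AB0; split=> //; exact: FA.
    by [].
  - have [Rv [_ bv]] := AE _ Azv; have : set0 (z, v).
      by rewrite -AB0; split=> //; exact: FB.
    by [].
have [||||KA|KB] := @connected_split_closed _ K (fst @` A) (fst @` B) coK.
- exact: clf.
- exact: clf.
- by rewrite -image_setU -EAB imE.
- move=> z _ [[z1 v] /= Av z1z] [[z2 w] /= Bw z2z].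
  by rewrite z1z in Av; rewrite z2z in Bw; exact: (fibre z v w).
- case: b Bb => z w Bzw; have [_ [Kz _]] := BE _ Bzw.
  by have [[z1 v] /= Av z1z] := KA _ Kz; apply: (fibre z v w) => //; rewrite -z1z.
- case: a Aa => z v Azv; have [_ [Kz _]] := AE _ Azv.
  by have [[z1 w] /= Bw z1z] := KB _ Kz; apply: (fibre z v w) => //; rewrite -z1z.
Qed.

Lemma liftable_monotone box R : compact box -> closed R ->
  (forall z, [set v | R (z, v) /\ box v] !=set0) ->
  (forall z, connected [set v | R (z, v) /\ box v]) ->
  liftable box R.
Proof.
move=> cbox clR Rn0 Rcon.
have lift K := @monotone_subcontinuum box R K cbox clR Rn0 Rcon.
move=> C sC; exists (R `&` (C `*` box)); split=> //; first by case: (lift C sC).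
move=> K sK KC; exists (R `&` (K `*` box)); have [sE imE] := lift K sK; split=> //.
by move=> p [Rp [Kp bp]]; split=> //; split=> //; exact: KC.
Qed.

Lemma liftable_graph box R (h : T -> V) : continuous h -> compact box ->
  (forall z, box (h z)) -> (forall z, R (z, h z)) -> liftable box R.
Proof.
move=> ch cbox hbox hR.
apply: (@liftable_sub _ [set p | p.2 = h p.1]) => [[z v] /= ->//|].
have fib z : [set v | [set p | p.2 = h p.1] (z, v) /\ box v] = [set h z].
  by apply/seteqP; split=> [v [/= ->]//|v ->]; split.
apply: liftable_monotone => // [|z|z]; last 2 first.
- by rewrite fib; exists (h z).
- by rewrite fib; exact: connected1.
exact: closed_graph.
Qed.

End Liftable.

(** * Imposing all the demands at once *)

Lemma comp_continuous (S T U : topologicalType) (f : S -> T) (g : T -> U) :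
  continuous f -> continuous g -> continuous (fun x => g (f x)).
Proof. by move=> cf cg x; apply: continuous_comp; [exact: cf|exact: cg]. Qed.

Lemma ptws_continuous (S V : topologicalType) (I : Type) (f : S -> {ptws I -> V}) :
  (forall i, continuous (fun x => f x i)) -> continuous f.
Proof.
move=> cf x; apply/cvg_sup => i.
exact: (@continuous_comp_initial _ _ _ (fun w : {ptws I -> V} => w i) f (cf i) x).
Qed.

Lemma ptws_proj_continuous (V : topologicalType) (I : eqType) (i : I) :
  continuous (fun w : {ptws I -> V} => w i).
Proof. exact: (@proj_continuous I (fun=> V) i). Qed.

Lemma hausdorff_ptws (V : topologicalType) (I : eqType) :
  hausdorff_space V -> hausdorff_space {ptws I -> V}.
Proof. by move=> hV; exact: (@hausdorff_product I (fun=> V)). Qed.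

Lemma compact_ptws (V : topologicalType) (I : eqType) (B : set V) : compact B ->
  compact [set w : {ptws I -> V} | forall i, B (w i)].
Proof. by move=> cB; exact: (@tychonoff I (fun=> V) (fun=> B)). Qed.

Lemma snd_ptws_continuous (X V : topologicalType) (I : eqType) (i : I) :
  continuous (fun y : X * {ptws I -> V} => y.2 i).
Proof.
exact: (comp_continuous (@snd_continuous _ _) (@ptws_proj_continuous V I i)).
Qed.

Section Demands.
Context {X V : topologicalType} {I : eqType}.
Let W : topologicalType := (X * {ptws I -> V})%type.
Variables (box S0 : set V) (rk : I -> nat) (demand : I -> set (W * V)) (t0 : I).
Hypotheses (hX : hausdorff_space X) (hV : hausdorff_space V)
  (sX : subcontinuum [set: X]).
Hypotheses (cbox : compact box) (sS0 : subcontinuum S0) (S0box : S0 `<=` box).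
Hypotheses (demand_lift : forall t, liftable box (demand t))
  (demand_closed : forall t, closed (demand t))
  (demand_rank : forall t x (w w' : {ptws I -> V}) v,
    (forall u, (rk u < rk t)%N -> w u = w' u) ->
    demand t ((x, w), v) -> demand t ((x, w'), v)).

Let hW : hausdorff_space W := hausdorff_pair hX (@hausdorff_ptws V I hV).

(** The induction invariant: only the demands listed in [s] hold so far, while the lifting of
    subcontinua of [X] and the free range [S0] of the coordinate [t0] are preserved. *)
Let good (s : seq I) (M : set W) :=
  [/\ subcontinuum M,
      M `<=` [set y | forall i, box (y.2 i)],
      forall t y, t \in s -> M y -> demand t (y, y.2 t),
      forall K, subcontinuum K ->
        exists L, [/\ subcontinuum L, L `<=` M & fst @` L = K] &
      forall v, S0 v -> exists2 y, M y & y.2 t0 = v].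

Let update t (p : W * V) : W :=
  (p.1.1, (fun i => if i == t then p.2 else p.1.2 i) : {ptws I -> V}).

Let update_continuous t : continuous (update t).
Proof.
apply: pair_continuous.
  exact: (comp_continuous (@fst_continuous _ _) (@fst_continuous _ _)).
apply: ptws_continuous => i /=; case: (i == t); first exact: snd_continuous.
exact: (comp_continuous (@fst_continuous _ _) (@snd_ptws_continuous _ _ _ i)).
Qed.

Let good_nil : exists M, good [::] M.
Proof.
(* Initially all coordinates share one value, which runs through [S0]. *)
pose c (p : X * V) : W := (p.1, (fun=> p.2) : {ptws I -> V}).
have cc : continuous c.
  apply: pair_continuous; first exact: fst_continuous.
  by apply: ptws_continuous => i; exact: snd_continuous.
have [cS0 coS0 [v0 S0v0]] := sS0.
have fib (z : X) : [set v | [set: X * V] (z, v) /\ S0 v] = S0.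
  by apply/seteqP; split=> [v []|v S0v].
have [|||sM imM] := @monotone_subcontinuum X V hX hV S0 setT setT cS0 closedT.
- by move=> z; rewrite fib; exists v0.
- by move=> z; rewrite fib.
- exact: sX.
exists (c @` ([set: X * V] `&` ([set: X] `*` S0))); split.
- exact: subcontinuum_image.
- by move=> _ [[x v] [_ [_ /= S0v]] <-] i /=; exact: S0box.
- by [].
- move=> K sK; exists (c @` ((fun x => (x, v0)) @` K)); split.
  + do 2!apply: subcontinuum_image => //.
    by apply: pair_continuous => x; [exact: cvg_id|exact: cvg_cst].
  + by move=> _ [_ [x Kx <-] <-]; exists (x, v0).
  + apply/seteqP; split=> [_ [_ [_ [x Kx <-] <-] <-]//|x Kx].
    by exists (c (x, v0)) => //; exists (x, v0) => //; exists x.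
- move=> v S0v; have [_ _ [x _]] := sX.
  by exists (c (x, v)) => //; exists (x, v).
Qed.

(** The demand at [t] is lifted over [M], and the new value overwrites coordinate [t]. Demands look
    only at coordinates of strictly smaller rank, so neither the demand at [t] nor the earlier ones,
    of rank at most [rk t], notice the change. *)
Let good_cons t s M : t \notin s -> t != t0 ->
  (forall u, u \in s -> (rk u <= rk t)%N) -> good s M ->
  exists M', good (t :: s) M'.
Proof.
move=> ts tt0 rkt [sM Mbox Ms MK MS0].
have [N [sN NM NL]] := demand_lift t sM.
have upd_neq u p : u != t -> (update t p).2 u = p.1.2 u.
  by move=> /negbTE ut; rewrite /= ut.
have upd_demand u p v : (rk u <= rk t)%N -> demand u (p.1, v) ->
    demand u (update t p, v).
  case: p => -[x w] v' rku /=; apply: demand_rank => u' rku' /=.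
  by case: eqP => // u't; move: (leq_trans rku' rku); rewrite u't ltnn.
exists (update t @` N); split.
- exact: subcontinuum_image.
- move=> _ [[y v] /NM[_ [/= My bv]] <-] i /=.
  by case: eqP => // _; exact: Mbox.
- move=> u _ + [[y v] /NM[Dt [/= My bv]] <-].
  rewrite in_cons => /orP[/eqP->|us].
    by rewrite {2}/update /= eqxx; exact: (upd_demand t (y, v)).
  rewrite upd_neq; last by apply: contraNneq ts => <-.
  by apply: (upd_demand u (y, v)); [exact: rkt|exact: Ms].
- move=> K sK; have [L [sL LM LK]] := MK K sK.
  have [L' [sL' L'N L'L]] := NL L sL LM.
  exists (update t @` L'); split; first exact: subcontinuum_image.
    exact: image_subset.
  rewrite -LK -L'L; apply/seteqP; split.
    by move=> _ [_ [p L'p <-] <-]; exists p.1 => //; exists p.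
  by move=> _ [_ [p L'p <-] <-]; exists (update t p) => //; exists p.
(* Lifting the one-point continuum at [y] gives a point of [N] above [y]; as [t] differs from [t0],
   overwriting leaves its coordinate [t0] alone. *)
- move=> v S0v; have [y My yv] := MS0 v S0v.
  have [|L' [[_ _ [p L'p]] L'N L'y]] := NL [set y] (subcontinuum1 y).
    by move=> _ ->.
  exists (update t p); first by exists p => //; exact: L'N.
  rewrite upd_neq 1?eq_sym //.
  by have -> : p.1 = y by (have : [set y] p.1 by rewrite -L'y; exists p).
Qed.

(** The list is processed from its tail, so decreasing rank along it means that terms of small rank
    come first. *)
Let good_sorted s : uniq s -> t0 \notin s ->
  sorted (fun u t => (rk t <= rk u)%N) s -> exists M, good s M.
Proof.
elim: s => [|t s IHs] /=; first by move=> *; exact: good_nil.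
move=> /andP[ts us]; rewrite in_cons negb_or => /andP[t0t t0s] pts.
have [M gM] := IHs us t0s (path_sorted pts).
apply: good_cons gM => //; first by rewrite eq_sym.
apply/allP; apply: order_path_min pts => u u' u'' le1 le2.
exact: leq_trans le2 le1.
Qed.

Let good_seq s : exists M, good [seq t <- s | t != t0] M.
Proof.
pose r u t := (rk t <= rk u)%N.
have [|||M [sM Mbox Ms MK MS0]] := @good_sorted (sort r (undup [seq t <- s | t != t0])).
- by rewrite sort_uniq undup_uniq.
- by rewrite mem_sort mem_undup mem_filter eqxx.
- by apply: sort_sorted => u t; exact: leq_total.
exists M; split=> // t y ts; apply: Ms.
by rewrite mem_sort mem_undup.
Qed.

Lemma demands_continuum : exists Y : set W,
  [/\ subcontinuum Y,
      forall t y, t != t0 -> Y y -> demand t (y, y.2 t),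
      forall K, subcontinuum K ->
        exists L, [/\ subcontinuum L, L `<=` Y & fst @` L = K] &
      forall v, S0 v -> exists2 y, Y y & y.2 t0 = v].
Proof.
have [M gM] := choice good_seq.
(* Along an ultrafilter containing these cones each single demand holds for almost all [s], and
   being closed it passes to the ultralimit. *)
pose G := filter_from [set: seq I] (fun s => [set s' : seq I | {subset s <= s'}]).
have GF : ProperFilter G.
  apply: filter_from_proper; last by move=> s _; exists s => u.
  apply: filter_from_filter; first by exists [::].
  move=> s s' _ _; exists (s ++ s') => // s'' ss'.
  by split=> u us; apply: ss'; rewrite mem_cat us ?orbT.
have [U [UU GU]] := ultraFilterLemma GF.
pose B : set W := [set: X] `*` [set w : {ptws I -> V} | forall i, box (w i)].
have cB : compact B.
  by apply: compact_setX; [case: sX|exact: compact_ptws].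
have MB s : M s `<=` B by case: (gM s) => _ Mbox _ _ _ y /Mbox By; split.
exists (ultralimit U M); split.
- by apply: ultralimit_subcontinuum hW cB MB _ => s; case: (gM s).
- move=> t y tt0 Yy.
  suff : ultralimit U M `<=` [set y | demand t (y, y.2 t)] by exact.
  apply: ultralimit_sub.
    apply: (@preimage_closed _ _ (fun y : W => (y, y.2 t))) => // z _.
    apply: pair_continuous => [z'|]; first exact: cvg_id.
    exact: snd_ptws_continuous.
  apply: GU; exists [:: t] => // s ts z Mz.
  have [_ _ Ms _ _] := gM s; apply: Ms => //.
  by rewrite mem_filter tt0 ts // inE.
- move=> K sK.
  have /choice[L LP] : forall s, exists L,
      [/\ subcontinuum L, L `<=` M s & fst @` L = K].
    by move=> s; case: (gM s) => _ _ _ /(_ K sK).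
  have LB s : L s `<=` B by apply: subset_trans (MB s); case: (LP s).
  exists (ultralimit U L); split.
  + by apply: ultralimit_subcontinuum hW cB LB _ => s; case: (LP s).
  + by apply: ultralimit_mono => s; case: (LP s).
  + apply: ultralimit_image hX _ cB LB _ _; first exact: fst_continuous.
      by apply: compact_closed => //; case: sK.
    by move=> s; case: (LP s).
- move=> v S0v.
  have /choice[y yP] : forall s, exists y, M s y /\ y.2 t0 = v.
    by move=> s; case: (gM s) => _ _ _ _ /(_ v S0v) [y My yv]; exists y.
  have yB s : [set y s] `<=` B by move=> _ ->; apply: (MB s); case: (yP s).
  have [|z Lz] := ultralimit_nonempty cB yB; first by move=> s; exists (y s).
  exists z; first by apply: ultralimit_mono Lz => s _ ->; case: (yP s).
  suff : ultralimit U (fun s => [set y s]) `<=` [set z | z.2 t0 = v] by exact.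
  apply: ultralimit_sub; last by apply: filterS filterT => s _ _ ->; case: (yP s).
  apply: (@preimage_closed _ _ (fun z : W => z.2 t0) [set v]).
    by move=> z' _; exact: snd_ptws_continuous.
  exact/accessible_closed_set1/hausdorff_accessible.
Qed.

End Demands.

(** * Zigzag folds *)

Local Open Scope ring_scope.

Section Fold.
Context {R : realType} {T V : topologicalType}.
Context (hT : hausdorff_space T) (hV : hausdorff_space V).
Variables (s : T -> R) (h0 h1 h2 : T -> V).
Hypotheses (cs : continuous s) (ch0 : continuous h0) (ch1 : continuous h1)
  (ch2 : continuous h2).
Hypotheses (h01 : forall z, s z = 2 -> h0 z = h1 z)
  (h12 : forall z, s z = 1 -> h1 z = h2 z).

(* An N-shaped curve, with three sheets where 1 <= [s] <= 2: [h0] and [h1] are glued over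
   [s = 2], [h1] and [h2] over [s = 1]. *)
Definition zigzag : set (T * V) := [set p |
  [\/ s p.1 <= 2 /\ p.2 = h0 p.1,
      1 <= s p.1 <= 2 /\ p.2 = h1 p.1 |
      1 <= s p.1 /\ p.2 = h2 p.1]].

Let E (K : set T) := zigzag `&` [set p | K p.1].

Let hTV : hausdorff_space (T * V)%type := hausdorff_pair hT hV.

Let closed_le2 : closed [set z | s z <= 2].
Proof.
apply: (@preimage_closed _ _ s [set x | x <= 2]) => //; exact: closed_le.
Qed.

Let closed_ge1 : closed [set z | 1 <= s z].
Proof.
apply: (@preimage_closed _ _ s [set x | 1 <= x]) => //; exact: closed_ge.
Qed.

Lemma zigzag_closed : closed zigzag.
Proof.
pose lift (D : set T) := [set p : T * V | D p.1].
have cl_lift D : closed D -> closed (lift D).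
  exact: (closed_preimage (@fst_continuous T V)).
have -> : zigzag = (lift [set z | s z <= 2] `&` [set p | p.2 = h0 p.1]) `|`
    (lift ([set z | 1 <= s z] `&` [set z | s z <= 2]) `&` [set p | p.2 = h1 p.1]) `|`
    (lift [set z | 1 <= s z] `&` [set p | p.2 = h2 p.1]).
  apply/seteqP; split=> p.
  - by move=> [|[/andP[]]|]; [left; left|left; right|right].
  - move=> [[|[[]]]|]; [exact: Or31| |exact: Or33].
    by move=> s1 s2 ph; apply: Or32; split=> //; exact/andP.
apply: closedU; first apply: closedU; apply: closedI; try exact: closed_graph.
- exact: cl_lift.
- by apply: cl_lift; exact: closedI.
- exact: cl_lift.
Qed.

Let zigzag_compact K : compact K -> compact (E K).
Proof.
move=> cK.
have graph (h : T -> V) (Z : set T) : continuous h -> closed Z ->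
    compact ((fun z => (z, h z)) @` (K `&` Z)).
  move=> ch clZ; apply: continuous_compact; last exact: compact_closedI.
  apply: continuous_subspaceT.
  by apply: pair_continuous => // z; exact: cvg_id.
have -> : E K = (fun z => (z, h0 z)) @` (K `&` [set z | s z <= 2]) `|`
    (fun z => (z, h1 z)) @` (K `&` ([set z | 1 <= s z] `&` [set z | s z <= 2])) `|`
    (fun z => (z, h2 z)) @` (K `&` [set z | 1 <= s z]).
  apply/seteqP; split=> [[z v] [[|[]|] /=]|[z v]].
  - by move=> [sz ->] Kz; left; left; exists z.
  - by move=> /andP[sz sz'] -> Kz; left; right; exists z.
  - by move=> [sz ->] Kz; right; exists z.
  - move=> [[|]|] [z' /=].
    + by move=> [Kz sz] [<- <-]; split=> //; apply: Or31.
    + move=> [Kz [sz sz']] [<- <-]; split=> //; apply: Or32; split=> //.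
      exact/andP.
    + by move=> [Kz sz] [<- <-]; split=> //; apply: Or33.
apply: compactU; first apply: compactU; apply: graph => //.
exact: closedI.
Qed.

(* The number modulo 2 of sheets over [z] that meet [A]. *)
Let parity (A : set (T * V)) z : bool :=
  (((s z <= 2) && `[< A (z, h0 z) >]) (+)
   ((1 <= s z <= 2) && `[< A (z, h1 z) >])) (+)
   ((1 <= s z) && `[< A (z, h2 z) >]).

(** Since [A] is clopen in [E K], membership in [A] is locally constant along a sheet. The condition
    [Z z] is deliberately not frozen at [z0], because the domain of a sheet may end there. *)
Let sheet_near K A (Z : T -> bool) (h : T -> V) z0 : piece (E K) A ->
  closed [set z | Z z] -> continuous h -> (forall z, K z -> Z z -> E K (z, h z)) ->
  K z0 ->
  \forall z \near z0, K z ->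
    Z z && `[< A (z, h z) >] = Z z && `[< A (z0, h z0) >].
Proof.
move=> [AE clA clEA] clZ ch hE Kz0.
have cg : continuous (fun z => (z, h z)).
  by apply: pair_continuous => // z; exact: cvg_id.
have away (B : set (T * V)) : closed B -> ~ B (z0, h z0) ->
    \forall z \near z0, ~ B (z, h z).
  move=> clB nB; apply: (cg z0 (~` B)); apply: open_nbhs_nbhs; split=> //.
  exact: closed_openC.
have [Zz0|nZz0] := boolP (Z z0); last first.
  have : nbhs z0 (~` [set z | Z z]).
    by apply: open_nbhs_nbhs; split; [exact: closed_openC|exact/negP].
  by apply: filterS => z /negP/negbTE ->.
have [Az0|nAz0] := pselect (A (z0, h z0)).
- have := away _ clEA (fun EA => EA.2 Az0); apply: filterS => z nEA Kz.
  have [Zz|//] := boolP (Z z); rewrite [RHS](asboolT Az0) asboolT //.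
  by apply: contrapT => nAz; apply: nEA; split=> //; exact: hE.
- by have := away _ clA nAz0; apply: filterS => z nAz Kz; rewrite !asboolF.
Qed.

(** A sheet can only begin or end where [s] is 1 or 2, and there it does so together with another
    sheet that takes the same value; the two contributions cancel modulo 2. *)
Let parity_const K A : connected K -> piece (E K) A ->
  forall z z', K z -> K z' -> parity A z -> parity A z'.
Proof.
move=> cK pA; apply: connected_locally_const => // z0 Kz0.
have n0 := sheet_near pA closed_le2 ch0 _ Kz0.
have n1 := @sheet_near K A (fun z => 1 <= s z <= 2) h1 z0 pA _ ch1 _ Kz0.
have n2 := sheet_near pA closed_ge1 ch2 _ Kz0.
have {n0} n0 := n0 (fun z Kz sz => conj (Or31 _ _ (conj sz erefl)) Kz).
have {n1} n1 := n1 _ (fun z Kz sz => conj (Or32 _ _ (conj sz erefl)) Kz).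
have {n2} n2 := n2 (fun z Kz sz => conj (Or33 _ _ (conj sz erefl)) Kz).
have cl12 : closed [set z | 1 <= s z <= 2].
  rewrite (_ : [set z | _] = [set z | 1 <= s z] `&` [set z | s z <= 2]).
    exact: closedI.
  by apply/seteqP; split=> z /andP.
have sopen (P : set R) : open P -> P (s z0) -> \forall z \near z0, P (s z).
  by move=> oP Ps; apply: (cs (x := z0)); exact: open_nbhs_nbhs.
have lt_near (c : R) : s z0 < c -> \forall z \near z0, s z < c.
  by move=> lt; apply: (sopen [set x | x < c]) => //; exact: open_lt.
have gt_near (c : R) : c < s z0 -> \forall z \near z0, c < s z.
  by move=> lt; apply: (sopen [set x | c < x]) => //; exact: open_gt.
(* Membership in [A] is frozen at [z0] and only the domains of the sheets vary with [z]. *)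
have main : \forall z \near z0,
  ((((s z <= 2) && `[< A (z0, h0 z0) >]) (+)
   ((1 <= s z <= 2) && `[< A (z0, h1 z0) >])) (+)
   ((1 <= s z) && `[< A (z0, h2 z0) >])) = parity A z0.
  rewrite /parity; have [lt1|[eq1|[[gt1 lt2]|[eq2|gt2]]]] : s z0 < 1 \/ s z0 = 1 \/
      (1 < s z0 /\ s z0 < 2) \/ s z0 = 2 \/ 2 < s z0.
    case: (ltgtP (s z0) 1) => [||]; [by left| |by right; left].
    by case: (ltgtP (s z0) 2) => ? ?; do 2 right; [left|right; right|right; left].
  - apply: filterS (lt_near _ lt1) => z zlt1.
    have -> : (s z <= 2) = true by lra.
    have -> : (1 <= s z) = false by lra.
    have -> : (s z0 <= 2) = true by lra.
    by have -> : (1 <= s z0) = false by lra.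
  - have lt2 : s z0 < 2 by lra.
    apply: filterS (lt_near _ lt2) => z zlt2.
    have -> : (s z <= 2) = true by lra.
    have -> : (s z0 <= 2) = true by lra.
    have -> : (1 <= s z0) = true by lra.
    by rewrite h12 // !andbT -!addbA !addbb.
  - near=> z.
    have zlt2 : s z < 2 by near: z; exact: lt_near.
    have zgt1 : 1 < s z by near: z; exact: gt_near.
    have -> : (s z <= 2) = true by lra.
    have -> : (1 <= s z) = true by lra.
    have -> : (s z0 <= 2) = true by lra.
    by have -> : (1 <= s z0) = true by lra.
  - have gt1 : 1 < s z0 by lra.
    apply: filterS (gt_near _ gt1) => z zgt1.
    have -> : (1 <= s z) = true by lra.
    have -> : (s z0 <= 2) = true by lra.
    have -> : (1 <= s z0) = true by lra.
    by rewrite h01 // !addbb.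
  - have gt1 : 1 < s z0 by lra.
    apply: filterS (gt_near _ gt2) => z zgt2.
    have -> : (s z <= 2) = false by lra.
    have -> : (1 <= s z) = true by lra.
    have -> : (s z0 <= 2) = false by lra.
    by have -> : (1 <= s z0) = true by lra.
near=> z => Kz; rewrite -(near main z) //.
rewrite /parity (near n0 z) // (near (n1 cl12) z) // (near n2 z) //.
Unshelve. all: by end_near. Qed.

Let parityU A B z : A `&` B = set0 ->
  parity (A `|` B) z = parity A z (+) parity B z.
Proof.
move=> AB0; have asU p : `[< (A `|` B) p >] = `[< A p >] (+) `[< B p >].
  rewrite /setU/= asbool_or; have [Ap|nAp] := pselect (A p).
    rewrite (asboolT Ap) asboolF // => Bp.
    by have : set0 p by rewrite -AB0.
  by rewrite (asboolF nAp).
rewrite /parity !asU !andb_addr.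
by do 6!case: (_ && _).
Qed.

Let parity_set0 z : parity set0 z = false.
Proof. by rewrite /parity !asboolF // !andbF. Qed.

(** Over [z] there are one or three sheets, counted with multiplicity where they are glued. *)
Let parity_full K z : K z -> parity (E K) z.
Proof.
move=> Kz; rewrite /parity.
have [s2|s2] := lerP (s z) 2; have [s1|s1] := lerP 1 (s z) => /=.
- rewrite !asboolT //; split=> //; [apply: Or33|apply: Or32|apply: Or31] => //=.
  by rewrite s1.
- by rewrite asboolT //; split=> //; exact: Or31.
- by rewrite asboolT //; split=> //; exact: Or33.
- by exfalso; lra.
Qed.

Let odd K A := piece (E K) A /\ forall z, K z -> parity A z.

(** Call a set small if it contains no odd piece. Parity is additive on disjoint pieces, so an odd
    piece inside a union of two pieces has an odd part in one of them; hence smallness passes to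
    unions of pieces, while [D] is not small. *)
Let odd_point K D : subcontinuum K -> odd K D ->
  exists2 e, D e & forall A, piece (E K) A -> A e ->
    exists2 B, B `<=` A & odd K B.
Proof.
move=> [cK coK [z0 Kz0]] [pD oD]; have cE := zigzag_compact cK.
have clE := compact_closed hTV cE; have [DE clD _] := pD.
have cD := subclosed_compact clD cE DE.
pose small A := forall B, B `<=` A -> ~ odd K B.
have [|A B pA pB sA sB C CAB oC|sD|e De eP] := @piece_not_small _ D small clD cD.
- move=> B; rewrite subset0 => -> [_ /(_ z0 Kz0)].
  by rewrite parity_set0.
- have pC := oC.1; have pA' := piece_trans pD pA.
  have CE : C = (C `&` A) `|` (C `\` A) by rewrite setUIDK.
  have [pCA|npCA] := boolP (parity (C `&` A) z0).
  + apply: (sA (C `&` A)) => //; split; first exact: pieceI.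
    move=> z Kz; apply: (parity_const coK _ Kz0 Kz pCA); exact: pieceI.
  + have pCD : piece (E K) (C `\` A).
      have -> : C `\` A = C `&` (E K `\` A).
        have [CE' _ _] := pC; apply/seteqP; split=> x [Cx]; last by case.
        by split=> //; split=> //; exact: CE'.
      by apply: pieceI => //; exact: pieceD.
    apply: (sB (C `\` A)); first by move=> x [/CAB[]].
    split=> // z Kz; apply: (parity_const coK pCD Kz0 Kz).
    have := oC.2 z0 Kz0; rewrite {1}CE parityU ?(negbTE npCA) //.
    by apply/seteqP; split=> // x [[_ Ax] []].
- exact: (sD D).
- exists e => // A pA Ae; apply: contrapT => nB.
  apply: (eP (A `&` D) (piece_restrict clD DE pA) (conj Ae De)).
  by move=> B BAD oB; apply: nB; exists B => // x /BAD[].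
Qed.

Let odd_restrict K K' A : closed (E K') -> K' `<=` K -> odd K A ->
  odd K' (A `&` E K').
Proof.
move=> clE K'K [pA oA]; split.
  by apply: piece_restrict pA => // p [Rp /K'K].
move=> z Kz; have := oA z (K'K z Kz); rewrite /parity.
have eqA (Z : bool) h : (Z -> zigzag (z, h z)) ->
    Z && `[< (A `&` E K') (z, h z) >] = Z && `[< A (z, h z) >].
  case: Z => // /(_ isT) zz; congr (_ && _); apply/asbool_equiv_eq.
  by split=> [[]//|Az]; split.
rewrite !eqA // => sz; [exact: Or33|exact: Or32|exact: Or31].
Qed.

(** [M] is the quasi-component of a point [e] all of whose clopen neighbourhoods contain odd pieces.
    For [K] inside [C], every such neighbourhood [A] contains a subcontinuum that projects onto [K];
    an ultralimit as [A] shrinks lies in every [A], hence in [M]. *)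
Lemma liftable_zigzag (box : set V) : (forall z, box (h0 z)) ->
  (forall z, box (h1 z)) -> (forall z, box (h2 z)) -> liftable box zigzag.
Proof.
move=> b0 b1 b2 C sC; have [cC coC [z0 Cz0]] := sC.
have cE := zigzag_compact cC; have clE := compact_closed hTV cE.
have oE : odd C (E C).
  by split; [exact: piece_refl|exact: parity_full].
have [e Ee eP] := odd_point sC oE.
exists (quasi_component (E C) e).
have QE := quasi_component_sub clE Ee; split.
- exact: quasi_component_subcontinuum.
- move=> [z v] /QE [Rzv /= Cz]; split=> //; split=> //=.
  by case: Rzv => -[_ /= ->].
move=> K sK KC; have [cK coK [zK KzK]] := sK.
have cEK := zigzag_compact cK; have clEK := compact_closed hTV cEK.
pose I := {A : set (T * V) | piece (E C) A /\ A e}.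
have liftA (i : I) : exists L, [/\ subcontinuum L, L `<=` E K, L `<=` sval i &
    fst @` L = K].
  case: i => A [pA Ae] /=; have [B BA oB] := eP A pA Ae.
  have oBK := odd_restrict clEK KC oB.
  have [e' [Be' Ee'] eP'] := odd_point sK oBK.
  exists (quasi_component (E K) e'); have Q'E := quasi_component_sub clEK Ee'.
  split=> //; first exact: quasi_component_subcontinuum.
    by move=> x /(_ _ oBK.1) [] // /BA.
  apply/seteqP; split=> [_ [p /Q'E [_ Kp] <-]//|z Kz].
  have [||[z' v'] [Qz /= z'z]] := @quasi_component_meet _ (E K) e' [set p | p.1 = z]
    clEK cEK Ee'.
  - rewrite (_ : [set p | _] = fst @^-1` [set z]) //.
    apply: preimage_closed; first by move=> ? _; exact: fst_continuous.
    exact/accessible_closed_set1/hausdorff_accessible.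
  (* Odd parity at [z] forces some sheet over [z] to meet the odd piece, so every clopen
     neighbourhood of [e'] has a point over [z]. *)
  - move=> B' pB' Be'2; have [B'' B''B' [[B''E _ _] oB'']] := eP' _ pB' Be'2.
    have := oB'' z Kz; rewrite /parity => par.
    suff [h B''h] : exists h : T -> V, B'' (z, h z).
      by exists (z, h z); split=> //; exact: B''B'.
    apply: contrapT => nh; move: par.
    by rewrite !asboolF ?andbF // => B''z; apply: nh; eexists; exact: B''z.
  - by exists (z', v').
have [L LP] := choice liftA.
pose G := filter_from [set: I] (fun i => [set j : I | sval j `<=` sval i]).
have GF : ProperFilter G.
  apply: filter_from_proper; last by move=> i _; exists i.
  apply: filter_from_filter.
    by exists (exist _ (E C) (conj (piece_refl clE) Ee)).
  move=> [A [pA Ae]] [B [pB Be]] _ _.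
  exists (exist _ (A `&` B) (conj (pieceI pA pB) (conj Ae Be))) => // j /= jAB.
  by split=> x /jAB [].
have [U [UU GU]] := ultraFilterLemma GF.
exists (ultralimit U L); split.
- by apply: ultralimit_subcontinuum cEK _ _ => // i; case: (LP i).
- move=> p Lp A pA Ae; have [_ clA _] := pA.
  suff : ultralimit U L `<=` A by exact.
  apply: ultralimit_sub => //; apply: GU.
  exists (exist _ A (conj pA Ae)) => // j /= jA x Lx.
  by apply: jA; have [_ _ Lj _] := LP j; exact: Lj.
- apply: (@ultralimit_image _ _ _ _ _ fst L (E K)) => //.
  + exact: fst_continuous.
  + by move=> i; case: (LP i).
  + exact: compact_closed.
  + by move=> i; case: (LP i).
Qed.

End Fold.

(** * Skeletons *)

Section Skeleton.
Context {R : realType}.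
Let V : topologicalType := {ptws nat -> R}.
Implicit Types (al : nat -> Prop) (v : V).

(* A copy of the 1-skeleton of the simplex on the allowed vertices [j < n],
   normalised by max = 1 instead of sum = 1 so that scaling the other
   coordinates contracts onto a vertex. *)
Definition skeleton n al : set V := [set v |
  [/\ forall j, 0 <= v j <= 1,
      forall j, v j = 0 \/ al j,
      forall i j k, i != j -> i != k -> j != k -> [\/ v i = 0, v j = 0 | v k = 0] &
      exists2 j, (j < n)%N & v j = 1]].

(** Every point contracts onto a vertex at which its coordinate is 1, and any two allowed vertices
    are joined through the midpoint of their edge. *)
Lemma skeleton_connected n al : connected (skeleton n al).
Proof.
pose vertex i : V := fun k => (k == i)%:R.
have path (v : V) i : skeleton n al v -> (i < n)%N -> v i = 1 ->
    connected_component (skeleton n al) (vertex i) v.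
  move=> [v01 val v3 _] ilt vi1.
  pose c (a : R) : V := fun k => if k == i then 1 else a * v k.
  have cc : continuous c.
    apply: ptws_continuous => k a; rewrite /c; case: (k == i).
      exact: cvg_cst.
    by apply: cvgMl; exact: cvg_id.
  have c0 a k : v k = 0 -> c a k = 0.
    move=> vk0; rewrite /c; case: eqP => [ki|_]; last by rewrite vk0 mulr0.
    by move: vk0; rewrite ki vi1 => /eqP; rewrite oner_eq0.
  exists (c @` `[0, 1]); last first.
    exists 1; first by rewrite /= in_itv /= ler01 lexx.
    by apply/funext => k; rewrite /c mul1r; case: eqP => // ->.
  split.
  - exists 0; first by rewrite /= in_itv /= ler01 lexx.
    by apply/funext => k; rewrite /c /vertex mul0r; case: eqP.
  - move=> _ [a /= a01 <-]; move: a01; rewrite in_itv /= => /andP[a0 a1].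
    split=> [j|j|j k l jk jl kl|].
    + rewrite /c; case: eqP => _; first by rewrite ler01 lexx.
      have /andP[vj0 vj1] := v01 j; rewrite mulr_ge0 //=.
      by rewrite mulr_ile1.
    + by have [vj0|] := val j; [left; exact: c0|right].
    + by have [?|?|?] := v3 j k l jk jl kl; [apply: Or31|apply: Or32|apply: Or33];
        exact: c0.
    + by exists i => //; rewrite /c eqxx.
  - apply: connected_continuous_connected; last exact: continuous_subspaceT.
    exact/connected_intervalP/interval_is_interval.
have vertexS i : (i < n)%N -> al i -> skeleton n al (vertex i).
  move=> ilt ali; split=> [j|j|j k l jk jl kl|].
  - by rewrite /vertex; case: eqP; rewrite ?lexx ?ler01.
  - by rewrite /vertex; case: eqP => [->|]; [right|left].
  - rewrite /vertex; have [jE|] := eqVneq j i; last by move=> _; apply: Or31.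
    have [kE|] := eqVneq k i; last by move=> _; apply: Or32.
    by move: jk; rewrite jE kE eqxx.
  - by exists i => //; rewrite /vertex eqxx.
have [[v0 Sv0]|S0] := pselect (skeleton n al !=set0); last first.
  have -> : skeleton n al = set0 by apply/nonemptyPn.
  exact: connected0.
have [_ al0 _ [i0 i0n v0i0]] := Sv0.
have ali0 : al i0.
  by have [v00|//] := al0 i0; move: v0i0; rewrite v00 => /esym/eqP; rewrite oner_eq0.
suff -> : skeleton n al = connected_component (skeleton n al) (vertex i0).
  exact: component_connected.
apply/seteqP; split; last exact: connected_component_sub.
move=> v Sv; have [_ alv _ [i ilt vi]] := Sv.
have ali : al i.
  by have [v00|//] := alv i; move: vi; rewrite v00 => /esym/eqP; rewrite oner_eq0.
apply: connected_component_trans (path v i Sv ilt vi).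
have [->|i0i] := eqVneq i0 i.
  by apply: connected_component_refl; exact: vertexS.
(* In the normalisation max = 1 this is the midpoint of the edge from [i0] to [i]; it contracts onto
   either end. *)
pose e : V := fun k => ((k == i0) || (k == i))%:R.
have Se : skeleton n al e.
  split=> [j|j|j k l jk jl kl|].
  - by rewrite /e; case: (_ || _); rewrite ?lexx ?ler01.
  - by rewrite /e; case: eqP => [->|]; [right|case: eqP => [->|]; [right|left]].
  - rewrite /e; have [jE|] := boolP ((j == i0) || (j == i)); last by move=> _; apply: Or31.
    have [kE|] := boolP ((k == i0) || (k == i)); last by move=> _; apply: Or32.
    have [lE|] := boolP ((l == i0) || (l == i)); last by move=> _; apply: Or33.
    by move: jk jl kl; case/orP: jE => /eqP ->; case/orP: kE => /eqP ->;
      case/orP: lE => /eqP ->; rewrite ?eqxx.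
  - by exists i0 => //; rewrite /e eqxx.
apply: (@connected_component_trans _ _ e).
  by apply: path => //; rewrite /e eqxx.
apply: connected_component_sym.
by apply: path => //; rewrite /e eqxx orbT.
Qed.

Lemma skeleton_nonempty n al i : (i < n)%N -> al i -> skeleton n al !=set0.
Proof.
move=> ilt ali; exists (fun k => (k == i)%:R); split=> [j|j|j k l jk jl kl|].
- by case: eqP; rewrite ?lexx ?ler01.
- by case: eqP => [->|]; [right|left].
- have [jE|] := eqVneq j i; last by move=> _; apply: Or31.
  have [kE|] := eqVneq k i; last by move=> _; apply: Or32.
  by move: jk; rewrite jE kE eqxx.
- by exists i => //; rewrite eqxx.
Qed.

Lemma skeleton_closed (T : topologicalType) n (al : T -> nat -> Prop) :
  (forall j, closed [set z | al z j]) ->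
  closed [set p : T * V | skeleton n (al p.1) p.2].
Proof.
move=> clal; have cp j : continuous (fun p : T * V => p.2 j).
  exact: snd_ptws_continuous.
have cl0 j : closed [set p : T * V | p.2 j = 0].
  exact: (@closed_preimage _ _ _ [set x : R | x = 0] (cp j) (@closed_eq _ _)).
have -> : [set p : T * V | skeleton n (al p.1) p.2] =
    (\bigcap_j ([set p | 0 <= p.2 j] `&` [set p | p.2 j <= 1])) `&`
    (\bigcap_j ([set p | p.2 j = 0] `|` [set p | al p.1 j])) `&`
    (\bigcap_i \bigcap_j \bigcap_(k in [set k | [/\ i != j, i != k & j != k]])
      ([set p | p.2 i = 0] `|` [set p | p.2 j = 0] `|` [set p | p.2 k = 0])) `&`
    (\bigcup_(j in `I_n) [set p | p.2 j = 1]).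
  apply/seteqP; split=> p.
  - move=> [p01 pal p3 [j jn pj]]; split; last by exists j.
    split; first by split=> k _; [have /andP[] := p01 k|exact: pal].
    move=> i _ k _ l [ik il kl].
    by have [||] := p3 i k l ik il kl; [left; left|left; right|right].
  - move=> [[[p01 pal] p3] [j jn pj]]; split=> [k|k|i k l ik il kl|].
    + by apply/andP; case: (p01 k I).
    + exact: (pal k I).
    + have [[|]|] : ([set p | p.2 i = 0] `|` [set p | p.2 k = 0] `|`
        [set p | p.2 l = 0]) p by apply: (p3 i I k I l).
      * exact: Or31.
      * exact: Or32.
      * exact: Or33.
    + by exists j.
apply: closedI; first apply: closedI; first apply: closedI.
- apply: closed_bigI => j _; apply: closedI.
    exact: (@closed_preimage _ _ _ [set x : R | 0 <= x] (cp j) (@closed_ge _ _)).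
  exact: (@closed_preimage _ _ _ [set x : R | x <= 1] (cp j) (@closed_le _ _)).
- apply: closed_bigI => j _; apply: closedU => //.
  exact: (closed_preimage (@fst_continuous T V) (clal j)).
- apply: closed_bigI => i _; apply: closed_bigI => j _; apply: closed_bigI => k _.
  by do 2!apply: closedU => //.
- apply: closed_bigcup => // j _.
  exact: (@closed_preimage _ _ _ [set x : R | x = 1] (cp j) (@closed_eq _ _)).
Qed.

End Skeleton.

(** * Terms and their demands *)

Section RealContinuous.
Context {R : realType} {T : topologicalType}.
Implicit Types f g : T -> R.

Lemma addr_continuous f g : continuous f -> continuous g ->
  continuous (fun z => f z + g z).
Proof. by move=> cf cg z; apply: cvgD; [exact: cf|exact: cg]. Qed.

Lemma subr_continuous f g : continuous f -> continuous g ->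
  continuous (fun z => f z - g z).
Proof. by move=> cf cg z; apply: cvgB; [exact: cf|exact: cg]. Qed.

Lemma mulr_continuous f g : continuous f -> continuous g ->
  continuous (fun z => f z * g z).
Proof. by move=> cf cg z; apply: cvgM; [exact: cf|exact: cg]. Qed.

Lemma cst_continuous_fun (a : R) : continuous (fun _ : T => a).
Proof. by move=> z; exact: cvg_cst. Qed.

End RealContinuous.

Section Terms.
Context {R : realType} {X : topologicalType} {B : choiceType}.
Variable g : B -> B -> X -> R.
Hypotheses (cg : forall b b', continuous (g b b')).
Let V : topologicalType := {ptws nat -> R}.

Definition term : Type := GenTree.tree B.
HB.instance Definition _ := Choice.on term.
Let W : topologicalType := (X * {ptws term -> V})%type.

(* No demand will be imposed on this coordinate, which keeps ranging over a
   whole interval. *)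
Definition free_term : term := GenTree.Node 0 [::].

Definition clamp (x : R) : R := Num.max 0 (Num.min 3 x).

Lemma clamp_itv x : 0 <= clamp x <= 3.
Proof. by rewrite /clamp le_max lexx ge_max ge_min lexx ler0n. Qed.

Lemma clamp_id x : 0 <= x <= 3 -> clamp x = x.
Proof.
by move=> /andP[x0 x3]; rewrite /clamp (min_idPr x3) (max_idPr x0).
Qed.

Lemma clamp_ge3 x : 3 <= x -> clamp x = 3.
Proof.
by move=> x3; rewrite /clamp (min_idPl x3); apply/max_idPr; rewrite ler0n.
Qed.

Lemma clamp_le0 x : x <= 0 -> clamp x = 0.
Proof.
move=> x0; rewrite /clamp; apply/max_idPl.
by rewrite ge_min x0 orbT.
Qed.

Lemma clamp_continuous (T : topologicalType) (f : T -> R) :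
  continuous f -> continuous (fun z => clamp (f z)).
Proof.
move=> cf z; apply: (@continuous_max _ _ (fun=> 0) (fun z => Num.min 3 (f z)) z).
  exact: cvg_cst.
by apply: (@continuous_min _ _ (fun=> 3) f z); [exact: cvg_cst|exact: cf].
Qed.

(** All coordinates live in sequence space, because skeleton coordinates need several real
    components; a real-valued coordinate is stored as a constant sequence. *)
Definition const_seq (x : R) : V := fun=> x.

Lemma const_seq_continuous (T : topologicalType) (f : T -> R) :
  continuous f -> continuous (fun z => const_seq (f z)).
Proof. by move=> cf; apply: ptws_continuous => i. Qed.

Definition lead_coord (y : W) (t : term) : R := y.2 t 0%N.

Lemma value_continuous t i : continuous (fun y : W => y.2 t i).
Proof.
exact: (comp_continuous (@snd_ptws_continuous _ V _ t) (@ptws_proj_continuous R _ i)).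
Qed.

(* Node labels encode the operations: 0 Urysohn function, 1 minimum, 2 fold,
   3 skeleton, [n.+4] affine image of one coordinate with data coded by [n]; any
   other tree gets the junk value 0. *)
Definition raw_scalar (t : term) (y : W) : R :=
  match t with
  | GenTree.Node 0 [:: GenTree.Leaf b; GenTree.Leaf b'] => g b b' y.1
  | GenTree.Node 1 ts => foldr (fun t r => Num.min (lead_coord y t) r) 3 ts
  | GenTree.Node n.+4 [:: t] =>
      if (choice.unpickle n : option (nat * int * int)) is Some (i, m, k)
      then m%:~R * y.2 t i + k%:~R else 0
  | _ => 0
  end.

(** The parameter of a fold: 0 where [u] is 3 and [u'] is 0, the middle value 3/2 where both vanish,
    and 3 where [u] is 0 and [u'] is 3. *)
Definition slope (u u' : term) (y : W) : R :=
  clamp ((3 + lead_coord y u' - lead_coord y u) / 2).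

(* The extra vertex [size ts] keeps the skeleton nonempty where the functions of
   [ts] are all small; it is forbidden where one of them exceeds 2. *)
Definition allowed (ts : seq term) (y : W) (j : nat) : Prop :=
  ((j < size ts)%N /\ 1 <= lead_coord y (nth free_term ts j)) \/
  (j = size ts /\ forall k, (k < size ts)%N -> lead_coord y (nth free_term ts k) <= 2).

(** With [s] the slope, the sheets of a fold are [s - 2], [2 - s] and [s]: the first two meet at
    value 0 for [s = 2], the last two at value 1 for [s = 1]. All values stay within [-3, 3]. *)
Definition demand (t : term) : set (W * V) :=
  match t with
  | GenTree.Node 2 [:: u; u'] =>
      zigzag (slope u u') (fun y => const_seq (slope u u' y - 2))
        (fun y => const_seq (2 - slope u u' y)) (fun y => const_seq (slope u u' y))
  | GenTree.Node 3 ts => [set p | skeleton (size ts).+1 (allowed ts p.1) p.2]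
  | _ => [set p | p.2 = const_seq (clamp (raw_scalar t p.1))]
  end.

Definition value_box : set V := [set v | forall i, v i \in `[-3, 3] ].

Lemma value_box_compact : compact value_box.
Proof. exact: (@compact_ptws R nat _ (@segment_compact R (-3) 3)). Qed.

Lemma raw_scalar_continuous t : continuous (raw_scalar t).
Proof.
have c0 : continuous (fun _ : W => 0 : R) by move=> y; exact: cvg_cst.
rewrite /raw_scalar; case: t => [b|[|[|[|[|n]]]] ts] //=.
- case: ts => [|[b|? ?] [|[b'|? ?] [|? ?]]] //=.
  exact: (comp_continuous (@fst_continuous _ _) (@cg b b')).
- elim: ts => [|t ts IHts] /= y; first exact: cvg_cst.
  apply: (@continuous_min _ _ (fun y => lead_coord y t)
    (fun y => foldr (fun t r => Num.min (lead_coord y t) r) 3 ts) y).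
    exact: value_continuous.
  exact: IHts.
- case: ts => [|t [|? ?]] //=.
  case: (choice.unpickle n : option (nat * int * int)) => [[[i m] k]|] //=.
  apply: addr_continuous; last exact: cst_continuous_fun.
  by apply: mulr_continuous; [exact: cst_continuous_fun|exact: value_continuous].
Qed.

Lemma slope_continuous u u' : continuous (slope u u').
Proof.
apply: clamp_continuous; apply: mulr_continuous; last exact: cst_continuous_fun.
apply: subr_continuous; last exact: value_continuous.
by apply: addr_continuous; [exact: cst_continuous_fun|exact: value_continuous].
Qed.

Lemma scalar_continuous t : continuous (fun y => const_seq (clamp (raw_scalar t y))).
Proof. exact/const_seq_continuous/clamp_continuous/raw_scalar_continuous. Qed.

Lemma allowed_closed ts j : closed [set y | allowed ts y j].
Proof.
have clle (c : bool) (t : term) (D : set R) : closed D ->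
    closed [set y : W | c /\ D (lead_coord y t)].
  case: c => clD; last first.
    by rewrite (_ : [set y | _] = set0); [exact: closed0|apply/seteqP; split=> ? []].
  rewrite (_ : [set y | _] = lead_coord ^~ t @^-1` D); last first.
    by apply/seteqP; split=> y; [case|split].
  by apply: closed_preimage => //; exact: value_continuous.
apply: closedU; first exact: (clle _ _ _ (@closed_ge R 1)).
have [jE|jE] := pselect (j = size ts); last first.
  rewrite (_ : (fun y : W => _) = set0); first exact: closed0.
  by apply/seteqP; split=> ? [].
rewrite (_ : (fun y : W => _) = \bigcap_(k in `I_(size ts))
    [set y : W | true /\ lead_coord y (nth free_term ts k) <= 2]); last first.
  by apply/seteqP; split=> [y [_ yk] k /yk|y yk]; split=> // k /yk [].
apply: closed_bigI => k _; exact: (clle true _ _ (@closed_le R 2)).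
Qed.

Hypothesis hX : hausdorff_space X.

Let hV : hausdorff_space V := @hausdorff_ptws R nat (@Rhausdorff R).
Let hW : hausdorff_space W := hausdorff_pair hX (@hausdorff_ptws V term hV).

Lemma demand_closed t : closed (demand t).
Proof.
have clg t' := closed_graph hV (@scalar_continuous t').
case: t => [b|[|[|[|[|n]]]] ts]; try exact: clg; last first.
  exact: (@skeleton_closed R W (size ts).+1 (allowed ts) (@allowed_closed ts)).
case: ts => [|u [|u' [|? ?]]]; try exact: clg.
have cs := @slope_continuous u u'.
apply: zigzag_closed => //.
- by apply: const_seq_continuous; apply: subr_continuous => //; exact: cst_continuous_fun.
- by apply: const_seq_continuous; apply: subr_continuous => //; exact: cst_continuous_fun.
- exact: const_seq_continuous.
Qed.

Lemma demand_lift t : liftable value_box (demand t).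
Proof.
have lg t' : liftable value_box [set p | p.2 = const_seq (clamp (raw_scalar t' p.1))].
  apply: (liftable_graph hW hV (@scalar_continuous t') value_box_compact).
    move=> z i; rewrite /= in_itv /=; have /andP[c0 c3] := clamp_itv (raw_scalar t' z).
    by rewrite c3 andbT (le_trans _ c0) // oppr_le0 ler0n.
  by [].
case: t => [b|[|[|[|[|n]]]] ts]; try exact: lg; last first.
  have skbox (z : W) : [set v | [set p : W * V |
      skeleton (size ts).+1 (allowed ts p.1) p.2] (z, v) /\ value_box v] = skeleton (size ts).+1 (allowed ts z).
    apply/seteqP; split=> [v []//|v sv]; split=> // i.
    have [v01 _ _ _] := sv; have /andP[v0 v1] := v01 i.
    by rewrite /= in_itv /=; apply/andP; split; lra.
  apply: liftable_monotone => //.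
  - exact: value_box_compact.
  - exact: (@skeleton_closed R W (size ts).+1 (allowed ts) (@allowed_closed ts)).
  - move=> z; rewrite skbox.
    have [[j [jlt fj]]|nj] := pselect (exists j, (j < size ts)%N /\
        1 <= lead_coord z (nth free_term ts j)).
      apply: (@skeleton_nonempty _ _ _ j); first exact: ltnW.
      by left.
    apply: (@skeleton_nonempty _ _ _ (size ts)) => //; right; split=> // k klt.
    rewrite leNgt; apply/negP => lt2; apply: nj; exists k; split=> //.
    by apply: ltW; apply: lt_trans lt2; rewrite ltr1n.
  - by move=> z; rewrite skbox; exact: skeleton_connected.
case: ts => [|u [|u' [|? ?]]]; try exact: lg.
have cs := @slope_continuous u u'.
have inbox (x : R) : -3 <= x <= 3 -> value_box (const_seq x).
  by move=> x3 i; rewrite /= in_itv.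
have s03 z : 0 <= slope u u' z /\ slope u u' z <= 3 by apply/andP; exact: clamp_itv.
apply: liftable_zigzag => //.
- by apply: const_seq_continuous; apply: subr_continuous => //; exact: cst_continuous_fun.
- by apply: const_seq_continuous; apply: subr_continuous => //; exact: cst_continuous_fun.
- exact: const_seq_continuous.
- by move=> z s2; congr const_seq; lra.
- by move=> z s1; congr const_seq; lra.
- by move=> z; apply: inbox; have := s03 z; lra.
- by move=> z; apply: inbox; have := s03 z; lra.
- by move=> z; apply: inbox; have := s03 z; lra.
Qed.

Definition rank (t : term) : nat := size (GenTree.encode t).

Lemma rank_child n ts t : t \in ts -> (rank t < rank (GenTree.Node n ts))%N.
Proof.
rewrite /rank /= size_rcons ltnS size_flatten => tts; apply: leqW.
elim: ts tts => //= u ts IHts; rewrite in_cons => /orP[/eqP->|/IHts le].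
  exact: leq_addr.
by apply: leq_trans le _; exact: leq_addl.
Qed.

Lemma demand_rank t x (w w' : {ptws term -> V}) v :
  (forall u, (rank u < rank t)%N -> w u = w' u) ->
  demand t ((x, w), v) -> demand t ((x, w'), v).
Proof.
case: t => [b|n ts] // ww'.
have child u : u \in ts -> w u = w' u by move=> uts; exact/ww'/rank_child.
have hchild u : u \in ts -> lead_coord (x, w) u = lead_coord (x, w') u.
  by rewrite /lead_coord /= => /child ->.
have scalE : raw_scalar (GenTree.Node n ts) (x, w) =
    raw_scalar (GenTree.Node n ts) (x, w').
  rewrite /raw_scalar; case: n {ww'} => [|[|[|[|n]]]] //.
    elim: ts hchild {child} => //= u ts IHts hchild.
    rewrite (hchild u) ?mem_head // IHts // => u' u'ts; apply: hchild.
    by rewrite in_cons u'ts orbT.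
  case: ts child hchild => [|t [|? ?]] //= child hchild.
  case: (choice.unpickle n : option (nat * int * int)) => [[[i m] k]|] //=.
  by rewrite child // inE.
have step : v = const_seq (clamp (raw_scalar (GenTree.Node n ts) (x, w))) ->
    v = const_seq (clamp (raw_scalar (GenTree.Node n ts) (x, w'))).
  by rewrite scalE.
case: n {ww' scalE} step => [|[|[|[|n]]]] step; try exact: step.
  case: ts child hchild step => [|u [|u' [|? ?]]] child hchild step; try exact: step.
  have sE : slope u u' (x, w) = slope u u' (x, w').
    by rewrite /slope !hchild // !inE eqxx ?orbT.
  by rewrite /demand /zigzag /mkset [(_, _).1]/= sE.
move=> [v01 val v3 vn]; split=> // j; have [|[[jlt al]|[jE al]]] := val j; first by left.
- by right; left; split=> //; rewrite -hchild // mem_nth.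
- by right; right; split=> // k klt; rewrite -hchild ?mem_nth //; exact: al.
Qed.

Theorem terms_continuum : subcontinuum [set: X] -> exists Y : set W,
  [/\ subcontinuum Y,
      forall t y, t != free_term -> Y y -> demand t (y, y.2 t),
      forall K, subcontinuum K ->
        exists L, [/\ subcontinuum L, L `<=` Y & fst @` L = K] &
      forall a, 0 <= a <= 1 -> exists2 y, Y y & y.2 free_term = const_seq a].
Proof.
move=> sX; pose S0 := const_seq @` `[0, 1].
have sS0 : subcontinuum S0.
  apply: subcontinuum_image; first by apply: const_seq_continuous => x; exact: cvg_id.
  split; first exact: segment_compact.
    exact/connected_intervalP/interval_is_interval.
  by exists 0; rewrite /= in_itv /= lexx ler01.
have S0box : S0 `<=` value_box.
  move=> _ [a /= a01 <-] i; move: a01; rewrite /= !in_itv /= => /andP[a0 a1].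
  by apply/andP; split; rewrite /const_seq; lra.
have [Y [sY YD YK YS]] := demands_continuum free_term hX hV sX value_box_compact
  sS0 S0box demand_lift demand_closed demand_rank.
exists Y; split=> // a a01; apply: YS.
by exists a => //=; rewrite in_itv.
Qed.

End Terms.

(** * Topology of a model of the demands *)

(** Integer coefficients keep the node labels countable. The gap 4 instead of 3 absorbs rounding:
    subtracting the ceiling puts the image of [a] in (-1, 0], so that of [b] exceeds 3. *)
Lemma exists_affine (R : realType) (a b : R) : a != b ->
  exists m k : int, m%:~R * a + k%:~R <= 0 /\ 3 <= m%:~R * b + k%:~R.
Proof.
move=> ab; have [m m4] : exists m : int, 4 <= m%:~R * (b - a).
  have := ab; rewrite neq_lt => /orP[lt|lt].
  - exists (Num.ceil (4 / (b - a))).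
    by rewrite -ler_pdivrMr ?subr_gt0 // ceil_ge.
  - exists (Num.floor (4 / (b - a))).
    have ba : b - a < 0 by rewrite subr_lt0.
    by rewrite -ler_ndivlMr // floor_le.
exists m, (- Num.ceil (m%:~R * a)).
have /andP[] := ceil_itv (m%:~R * a); rewrite intrB => c1 c2.
rewrite rmorphN /=; split; first lra.
by move: m4; rewrite mulrBr; lra.
Qed.

Lemma count_le2 (T : eqType) (P : pred T) (s : seq T) : uniq s ->
  (forall x y z, x != y -> x != z -> y != z -> P x -> P y -> P z -> False) ->
  (count P s <= 2)%N.
Proof.
move=> us P3; rewrite -size_filter.
have := seq.filter_uniq P us; have := seq.filter_all P s.
case: (seq.filter P s) => [|x [|y [|z l]]] //= /and4P[Px Py Pz _].
rewrite !inE !negb_or => /and3P[/and3P[xy xz _] /andP[yz _] _].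
by case: (P3 x y z).
Qed.

Section Model.
Context {R : realType} {X : topologicalType} {B : choiceType}.
Variable g : B -> B -> X -> R.
Hypothesis g_separates : forall x x', x != x' ->
  exists b b', g b b' x = 0 /\ g b b' x' = 3.
Let V : topologicalType := {ptws nat -> R}.
Let W : topologicalType := (X * {ptws term (B := B) -> V})%type.
Context {T : topologicalType}.
Variable j : T -> W.
Hypotheses (hT : hausdorff_space T) (cT : compact [set: T]).
Hypotheses (cj : continuous j) (jinj : injective j)
  (jD : forall y t, t != free_term -> demand g t (j y, (j y).2 t)).

Definition level (t : term) (y : T) : R := lead_coord (j y) t.

Lemma level_continuous t : continuous (level t).
Proof. exact: (comp_continuous cj (@value_continuous _ _ _ _ 0%N)). Qed.

Lemma closed_compactT (A : set T) : closed A -> compact A.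
Proof. by move=> clA; exact: subclosed_compact clA cT _. Qed.

Definition affine_term (i : nat) (m k : int) (u : term (B := B)) : term (B := B) :=
  GenTree.Node (choice.pickle (i, m, k)).+4 [:: u].

Lemma level_affine i m k u y :
  level (affine_term i m k u) y = clamp (m%:~R * (j y).2 u i + k%:~R).
Proof.
have /= := @jD y (affine_term i m k u) isT; rewrite /level /lead_coord => ->.
by rewrite /= choice.pickleK.
Qed.

(** Points with distinct images in [X] are separated by a Urysohn term. Otherwise injectivity of [j]
    gives a component of some coordinate where they differ, and a clamped affine image of it has the
    two required values. *)
Lemma separate_points y y' : y != y' -> exists t, level t y = 0 /\ level t y' = 3.
Proof.
move=> yy'; have [xx'|xx'] := eqVneq (j y).1 (j y').1; last first.
  have [b [b' [gx gx']]] := g_separates xx'.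
  pose t := GenTree.Node 0 [:: GenTree.Leaf b; GenTree.Leaf b'].
  have lt z : level t z = clamp (g b b' (j z).1).
    by have /= := @jD z t isT; rewrite /level /lead_coord => ->.
  exists t; rewrite !lt gx gx' clamp_le0 // clamp_ge3 //.
have [u [i ui]] : exists u i, (j y).2 u i != (j y').2 u i.
  apply: contrapT => nui; move/eqP: yy'; apply; apply: jinj.
  rewrite (surjective_pairing (j y)) (surjective_pairing (j y')) xx'; congr (_, _).
  apply/funext => u; apply/funext => i; apply/eqP; apply: contrapT => /negP ui.
  by apply: nui; exists u, i.
have [m [k [le0 ge3]]] := exists_affine ui.
by exists (affine_term i m k u); rewrite !level_affine clamp_le0 // clamp_ge3.
Qed.

Lemma separate_closed (A : set T) p : closed A -> ~ A p ->
  exists t, [/\ level t p = 3, forall a, A a -> level t a = 0 &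
    forall y, 0 <= level t y <= 3].
Proof.
move=> clA nAp.
have [|a Aa|D [Dp AD]] := @compact_subcover _ _ A [set t | level t p = 3]
  (fun t => [set y | level t y < 1]) (closed_compactT clA).
- move=> t _; exact: (open_preimage (@level_continuous t) (@open_lt R 1)).
- have [|t [ta tp]] := @separate_points a p.
    by apply/eqP => ap; apply: nAp; rewrite -ap.
  by exists t => //=; rewrite ta.
pose u := GenTree.Node 1 D.
(* [Negz 1] is -2. The map [2 x - 2], clamped, keeps the value 3 at [p] and sends the values below 1
   that the minimum takes on [A] to 0. *)
pose t := affine_term 0 (Posz 2) (Negz 1) u.
have lu y : level u y = clamp (foldr (fun t r => Num.min (level t y) r) 3 D).
  by have /= := @jD y u isT; rewrite /level /lead_coord => ->.
have lt y : level t y = clamp (2 * level u y - 2).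
  by rewrite level_affine.
exists t; split=> [|a Aa|y]; last by rewrite lt clamp_itv.
- rewrite lt lu; have -> : foldr (fun t r => Num.min (level t p) r) 3 D = 3.
    have : forall t, t \in D -> level t p = 3 by [].
    elim: (D) => //= t' l IHl lp.
    rewrite lp ?mem_head // IHl ?minxx // => t'' t''l.
    by apply: lp; rewrite in_cons t''l orbT.
  by rewrite (@clamp_ge3 R 3) // clamp_ge3 //; lra.
- have [t' Dt' lt'] := AD _ Aa.
  rewrite lt clamp_le0 // lu.
  have : foldr (fun t r => Num.min (level t a) r) 3 D <= level t' a.
    elim: (D) Dt' => //= t'' l IHl; rewrite in_cons ge_min => /orP[/eqP->|/IHl->].
      by rewrite lexx.
    by rewrite orbT.
  set m := foldr _ _ _ => mle; have := lt'; rewrite /= => lt1.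
  have [m0|m0] := lerP m 0; first by rewrite clamp_le0 //; lra.
  by rewrite clamp_id //; [lra|apply/andP; split; lra].
Qed.

Lemma level_basis : basis (range (fun t => [set y | 0 < level t y])).
Proof.
split=> [_ [t _ <-]|y U].
  exact: (open_preimage (@level_continuous t) (@open_gt R 0)).
rewrite nbhsE => -[N [oN Ny] NU].
have [|t [ty tN _]] := @separate_closed (~` N) y (open_closedC oN).
  by move=> /(_ Ny).
exists [set z | 0 < level t z]; first by split; [exists t|rewrite /= ty].
move=> z /= tz; apply: NU; apply: contrapT => nNz.
by move: tz; rewrite tN // ltxx.
Qed.

(** If neither of [K] and [L] contains the other, take [u] equal to 3 at [p] and 0 on [L], and [v]
    equal to 3 at [q] and 0 on [K]. The fold of [u] and [v] then confines [K] and [L] to disjoint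
    ranges, which is impossible at the common point [r]. *)
Lemma model_hereditarily_indecomposable : hereditarily_indecomposable T.
Proof.
move=> K L [cK coK _] [cL coL _] [r [Kr Lr]].
have [clK clL] := (compact_closed hT cK, compact_closed hT cL).
apply: contrapT => /not_orP[/existsNP[p /not_implyP[Kp nLp]]
  /existsNP[q /not_implyP[Lq nKq]]].
have [u [up uL u03]] := separate_closed clL nLp.
have [v [vq vK v03]] := separate_closed clK nKq.
pose t := GenTree.Node 2 [:: u; v].
pose s y : R := clamp ((3 + level v y - level u y) / 2).
have lt y : [\/ s y <= 2 /\ level t y = s y - 2,
    1 <= s y <= 2 /\ level t y = 2 - s y | 1 <= s y /\ level t y = s y].
  have := @jD y t isT.
  case=> /= [[sy e]|[sy e]|[sy e]]; [apply: Or31|apply: Or32|apply: Or33]; split=> //;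
    by rewrite /level /lead_coord e.
have sK y : K y -> s y = (3 - level u y) / 2.
  move=> Ky; have /andP[u0 u3] := u03 y.
  by rewrite /s vK // addr0 clamp_id //; apply/andP; split; lra.
have sL y : L y -> s y = (3 + level v y) / 2.
  move=> Ly; have /andP[v0 v3] := v03 y.
  by rewrite /s uL // subr0 clamp_id //; apply/andP; split; lra.
have clle c : closed [set y | level t y <= c].
  exact: (closed_preimage (@level_continuous t) (@closed_le R c)).
have clge c : closed [set y | c <= level t y].
  exact: (closed_preimage (@level_continuous t) (@closed_ge R c)).
(* On [K] the slope is at most 3/2, so the first sheet stays below -1/2 and the other two above 1/2.
   The point [p], where the slope is 0, puts [K] on the first sheet. *)
have Kle y : K y -> level t y <= - (1 / 2).
  have [||x Kx|x Kx /= l1 l2|Kle|Kge] := @connected_split_closed _ K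
    [set y | level t y <= - (1 / 2)] [set y | 1 / 2 <= level t y] coK.
  - exact: clle.
  - exact: clge.
  - have /andP[u0 u3] := u03 x; have := sK x Kx.
    by case: (lt x) => [[s1 e]|[/andP[s1 s2] e]|[s1 e]] sE;
      [left|right|right] => /=; lra.
  - lra.
  - exact: Kle.
  - have := Kge p Kp; have := sK p Kp; rewrite up /=.
    by case: (lt p) => [[s1 e]|[/andP[s1 s2] e]|[s1 e]] sE; lra.
(* On [L] the slope is at least 3/2, so the first two sheets stay below 1/2 and the last above 3/2;
   the slope 3 at [q] selects the last. *)
have Lge y : L y -> 3 / 2 <= level t y.
  have [||x Lx|x Lx /= l1 l2|Lle|Lge] := @connected_split_closed _ L
    [set y | level t y <= 1 / 2] [set y | 3 / 2 <= level t y] coL.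
  - exact: clle.
  - exact: clge.
  - have /andP[v0 v3] := v03 x; have := sL x Lx.
    by case: (lt x) => [[s1 e]|[/andP[s1 s2] e]|[s1 e]] sE;
      [left|left|right] => /=; lra.
  - lra.
  - have := Lle q Lq; have := sL q Lq; rewrite vq /=.
    by case: (lt q) => [[s1 e]|[/andP[s1 s2] e]|[s1 e]] sE; lra.
  - exact: Lge.
by have := Kle r Kr; have := Lge r Lr; lra.
Qed.

(** Choose a finite cover by sets where a level exceeds 2, each level vanishing off a member of [s].
    The sets where a component of the corresponding skeleton coordinate is positive refine [s], and
    at most two components are positive at once. *)
Lemma model_dim_le1 : covering_dim_le T 1.
Proof.
move=> s os scov.
have [|y _|D [DU TD]] := @compact_subcover _ _ setT
  [set t | exists2 U, U \in s & forall y, ~ U y -> level t y = 0]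
  (fun t => [set y | 2 < level t y]) cT.
- move=> t _; exact: (open_preimage (@level_continuous t) (@open_gt R 2)).
- have [U Us Uy] := scov y.
  have [|t [ty tU _]] := @separate_closed (~` U) y (open_closedC (os U Us)).
    by move=> /(_ Uy).
  by exists t; [exists U|rewrite /= ty; lra].
pose ts := D; pose e := GenTree.Node 3 ts.
pose P i := [set y | 0 < (j y).2 e i].
have sk y : skeleton (size ts).+1 (allowed ts (j y)) (@snd X _ (j y) e) := @jD y e isT.
have Pallowed y i : (i < size ts)%N -> P i y -> 1 <= level (nth free_term ts i) y.
  have [_ al _ _] := sk y; rewrite /P /= => ilt Pi.
  have [e0|[[_ //]|[isz _]]] := al i; first by move: Pi; rewrite e0 ltxx.
  by move: ilt; rewrite isz ltnn.
exists [seq P i | i <- iota 0 (size ts)]; split.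
- move=> _ /mapP[i _ ->].
  have ci : continuous (fun y => (j y).2 e i).
    exact: (comp_continuous cj (@value_continuous _ _ _ _ i)).
  exact: (open_preimage ci (@open_gt R 0)).
- move=> y; have [_ al _ [i ilt ei]] := sk y.
  have [e0|[[ilt' _]|[_ le2]]] := al i.
  + by move: ei; rewrite e0 => /esym/eqP; rewrite oner_eq0.
  + exists (P i); last by rewrite /P /= ei.
    by apply/mapP; exists i => //; rewrite mem_iota.
  (* A component equal to 1 cannot belong to the extra vertex, since some level of the cover exceeds
     2 at [y]. *)
  + have [t Dt /= t2] := TD y I.
    have := le2 (index t ts); rewrite index_mem nth_index // => /(_ Dt).
    by rewrite leNgt t2.
- move=> _ /mapP[i + ->]; rewrite mem_iota add0n => /andP[_ ilt].
  have /DU[U Us tU] : nth free_term ts i \in D by exact: mem_nth.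
  exists U => // y Py; apply: contrapT => nUy.
  by have := Pallowed y i ilt Py; rewrite tU // ler10.
- move=> y; rewrite count_map; apply: count_le2 => [|i k l ik il kl].
    exact: iota_uniq.
  rewrite /= !asboolE /P /= => Pi Pk Pl; have [_ _ v3 _] := sk y.
  by have [e0|e0|e0] := v3 i k l ik il kl; [move: Pi|move: Pk|move: Pl];
    rewrite e0 ltxx.
Qed.

End Model.

(** * Subspaces, dimension and weight *)

Section Subtype.
Context {W : topologicalType} (hW : hausdorff_space W) (Y : set W).

Let inc (y : Y) : W := set_val y.

Lemma set_val_continuous : continuous inc.
Proof. exact: initial_continuous. Qed.

Lemma set_val_injective : injective inc.
Proof. exact: val_inj. Qed.

Lemma set_valY (y : Y) : Y (inc y).
Proof. exact: set_valP. Qed.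

Lemma subtype_hausdorff : hausdorff_space Y.
Proof.
move=> p q clpq; apply: set_val_injective; apply: hW.
exact: (cluster_nbhs_image set_val_continuous clpq).
Qed.

Lemma subtype_compact (L : set W) : L `<=` Y -> compact L -> compact (inc @^-1` L).
Proof.
move=> LY cL F FF FL.
have [|x [Lx clx]] := cL (inc @ F) _; first exact: FL.
exists (SigSub (mem_set (LY x Lx))); split=> //.
move=> A N FA [_ [[G oG <-] Gx GN]].
have [|w [[a Aa <-] Gw]] := clx (inc @` A) G _ (open_nbhs_nbhs (conj oG Gx)).
  by apply: (@filterS _ F _ A (inc @^-1` (inc @` A)) _ FA) => a Aa; exists a.
by exists a; split=> //; exact: GN.
Qed.

Lemma subtype_subcontinuum (L : set W) : L `<=` Y -> subcontinuum L ->
  subcontinuum (inc @^-1` L) /\ inc @` (inc @^-1` L) = L.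
Proof.
move=> LY [cL coL [x Lx]].
have imL : inc @` (inc @^-1` L) = L.
  apply/seteqP; split=> [_ [y Ly <-]//|w Lw].
  by exists (SigSub (mem_set (LY w Lw))).
have cL' := subtype_compact LY cL; have clL' := compact_closed subtype_hausdorff cL'.
split=> //; split=> //; last by exists (SigSub (mem_set (LY x Lx))).
apply: closed_connectedP => // A B clA clB LAB AB0 [a Aa] [b Bb].
have clim C : closed C -> C `<=` inc @^-1` L -> closed (inc @` C).
  move=> clC CL; apply: compact_closed => //; apply: continuous_compact.
    exact/continuous_subspaceT/set_val_continuous.
  exact: subclosed_compact clC cL' CL.
have [AL BL] : A `<=` inc @^-1` L /\ B `<=` inc @^-1` L by rewrite -subUset -LAB.
have disj y z : A y -> B z -> inc y = inc z -> False.
  move=> Ay Bz /set_val_injective yz; have : set0 y; last by [].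
  by rewrite -AB0; split=> //; rewrite yz.
have [||||LA|LB] := @connected_split_closed _ L (inc @` A) (inc @` B) coL.
- exact: clim.
- exact: clim.
- by rewrite -image_setU -LAB imL.
- by move=> w _ [y Ay yw] [z Bz zw]; apply: (disj y z) => //; rewrite yw zw.
- by have [y Ay yb] := LA _ (BL _ Bb); exact: (disj y b).
- by have [z Bz za] := LB _ (AL _ Aa); exact: (disj a z).
Qed.

End Subtype.

(** Refine the cover by the complements of [p] and [q]. In a refinement of order one distinct
    members are disjoint, so by connectedness the member containing [p] is the whole space, yet it
    must miss [p] or [q]. *)
Lemma connected_dim_neq0 (T : topologicalType) (p q : T) :
  hausdorff_space T -> connected [set: T] -> p <> q -> ~ covering_dim_le T 0.
Proof.
move=> hT coT pq dim0.
have clpt (z : T) : closed [set z].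
  exact/accessible_closed_set1/hausdorff_accessible.
have [||r [ro rcov rref rcount]] := dim0 [:: ~` [set p]; ~` [set q]].
- by move=> U; rewrite !inE => /orP[]/eqP->; exact: closed_openC.
- move=> x; have [->|xp] := pselect (x = p).
    by exists (~` [set q]); rewrite ?inE ?eqxx ?orbT.
  by exists (~` [set p]); rewrite ?inE ?eqxx.
have one U U' x : U \in r -> U' \in r -> U x -> U' x -> U = U'.
  move=> Ur U'r Ux U'x; apply/eqP; apply: contraT => UU'.
  have := rcount x; rewrite leqNgt => /negP; case.
  rewrite -size_filter; apply: (@leq_trans (size [:: U; U'])) => //.
  apply: uniq_leq_size; first by rewrite /= inE UU'.
  move=> C; rewrite !inE mem_filter => /orP[]/eqP->; apply/andP; split=> //;
    exact/asboolP.
have [U Ur Up] := rcov p.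
pose U' := [set x | exists2 C, C \in r & C x /\ ~ C p].
have oU' : open U'.
  rewrite openE => x [C Cr [Cx nCp]].
  apply: filterS (open_nbhs_nbhs (conj (ro C Cr) Cx)) => y Cy.
  by exists C.
have [||TU|TU'] := @connected_split_open _ setT U U' coT (ro U Ur) oU'.
- move=> x _; have [C Cr Cx] := rcov x.
  have [Cp|nCp] := pselect (C p); last by right; exists C.
  by left; rewrite (one U C p).
- by move=> x _ Ux [C Cr [Cx]]; rewrite -(one U C x).
- have [C] := rref U Ur; rewrite !inE => /orP[]/eqP-> UC.
    exact: (UC p Up erefl).
  exact: (UC q (TU q I) erefl).
- by have [C _ [Cp]] := TU' p I.
Qed.

(** Since [f] is a closed map with compact fibres, the complements of images of complements of
    finite unions from [BT] form a base of [X]. It is indexed by finite sequences over [BT]. *)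
Lemma compact_image_basis_le (T X : topologicalType) (f : T -> X)
    (BX : set (set X)) (BT : set (set T)) :
  hausdorff_space X -> compact [set: T] -> continuous f ->
  f @` [set: T] = [set: X] -> basis BT ->
  (forall B : set (set X), basis B -> BX #<= B) ->
  BX #<= BT \/ BX #<= [set: nat].
Proof.
move=> hX cT cf fsurj [BTo BTb] BXmin.
pose img (s : seq BT) : set X :=
  ~` (f @` (~` [set y | exists2 N, N \in s & set_val N y])).
have seqBT : [set: seq BT] #<= BT \/ [set: seq BT] #<= [set: nat].
  have [c|c] := card_seq BT; [left|by right].
  by apply: card_le_trans c _; have /card_eqPle[] := card_setT BT.
suff imgb : basis (range img).
  have le1 := card_le_trans (BXmin _ imgb) (card_image_le img setT).
  by case: seqBT => c; [left|right]; exact: card_le_trans le1 c.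
split=> [_ [s _ <-]|x U].
  apply: closed_openC; apply: compact_closed => //; apply: continuous_compact.
    exact: continuous_subspaceT.
  apply: subclosed_compact cT _ => //; apply: open_closedC.
  rewrite openE => y [N Ns Ny].
  have oN := BTo _ (set_valP N).
  by apply: filterS (open_nbhs_nbhs (conj oN Ny)) => z Nz; exists N.
rewrite nbhsE => -[N [oN Nx] NU].
have cfib : compact (f @^-1` [set x]).
  apply: subclosed_compact cT _ => //; apply: closed_preimage => //.
  exact/accessible_closed_set1/hausdorff_accessible.
have [|y fy|s [sD scov]] := @compact_subcover _ BT _
  [set M : BT | set_val M `<=` f @^-1` N] (fun M => set_val M) cfib.
- by move=> M _; exact/BTo/set_valP.
- have [|M [BM My] MN] := BTb y (f @^-1` N).
    apply: open_nbhs_nbhs; split; first exact: open_preimage.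
    by rewrite /= fy.
  by exists (SigSub (mem_set BM)).
exists (img s) => [|z imgz].
  split; first by exists s.
  by move=> [y ny fy]; apply: ny; exact: scov.
apply: NU; have [y _ yz] : (f @` [set: T]) z by rewrite fsurj.
have [M Ms My] : exists2 M, M \in s & set_val M y.
  by apply: contrapT => nM; apply: imgz; exists y.
by rewrite -yz; exact: (sD M Ms).
Qed.

(** * Size of the set of terms, Urysohn functions and minimal bases *)

Lemma card_term (B : choiceType) (b0 : B) :
  [set: term (B := B)] #<= [set: B] \/ [set: term (B := B)] #<= [set: nat].
Proof.
have [|c|c] := @card_le_seq (nat + B)%type (term (B := B)) (@GenTree.encode B).
- exact: pcan_inj (@GenTree.codeK B).
(* Length one is reserved for the leaves, so numbers become constant sequences of length at least
   two. *)
- pose f (x : nat + B) := match x with inl n => nseq n.+2 b0 | inr b => [:: b] end.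
  have finj : injective f.
    move=> [n|b] [n'|b'] //= [].
    + by move=> /(congr1 size); rewrite !size_nseq => ->.
    + by move=> ->.
  have [cB|cN] := card_le_seq finj; [left|right]; exact: card_le_trans c _.
- by right.
Qed.

(** The conditions on [U] and [N] sit inside the conclusion so that choice yields a function for
    every pair of basic sets, the zero function for unsuitable ones. *)
Lemma urysohn_family (R : realType) (X : topologicalType) (U N : set X) :
  hausdorff_space X -> compact [set: X] -> exists f : X -> R, continuous f /\
    (open N -> closure U `<=` N ->
      (forall x, U x -> f x = 0) /\ (forall x, ~ N x -> f x = 3)).
Proof.
move=> hX cX; have [[oN UN]|no] := pselect (open N /\ closure U `<=` N); last first.
  by exists (fun=> 0); split=> [x|oN UN]; [exact: cvg_cst|case: no].
have sep := (@normal_separatorP R X).1 (compact_normal hX cX).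
have /(@uniform_separatorP X R)[f [cf _ f0 f1]] : uniform_separator (closure U) (~` N).
  apply: sep; [exact: closed_closure|exact: open_closedC|].
  by apply/disjoints_subset; rewrite setCK.
exists (fun x => 3 * f x); split.
  by apply: mulr_continuous => //; exact: cst_continuous_fun.
move=> _ _; split=> x Ux.
  have -> : f x = 0 by apply: f0; exists x => //; exact: subset_closure.
  by rewrite mulr0.
have -> : f x = 1 by apply: f1; exists x.
by rewrite mulr1.
Qed.

Lemma exists_min_basis (X : topologicalType) :
  exists2 B : set (set X), basis B & forall B' : set (set X), basis B' -> B #<= B'.
Proof.
have openb : basis [set U : set X | open U].
  split=> // x U; rewrite nbhsE => -[N [oN Nx] NU].
  by exists N.
have [[B bB] Bmin] := @exists_min_card {B : set (set X) | basis B} (fun=> set X)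
  sval (inhabits (exist _ _ openb)).
by exists B => // B' bB'; exact: (Bmin (exist _ B' bB')).
Qed.

Lemma urysohn_family_separates (R : realType) (X : topologicalType)
    (B : set (set X)) :
  hausdorff_space X -> compact [set: X] -> basis B ->
  exists g : B -> B -> X -> R, (forall b b', continuous (g b b')) /\
    forall x x', x != x' -> exists b b', g b b' x = 0 /\ g b b' x' = 3.
Proof.
move=> hX cX [Bo Bb].
have /choice[g gP] : forall p : B * B, exists f : X -> R, continuous f /\
    (open (set_val p.2) -> closure (set_val p.1) `<=` set_val p.2 ->
      (forall x, set_val p.1 x -> f x = 0) /\ (forall x, ~ set_val p.2 x -> f x = 3)).
  by move=> p; exact: urysohn_family.
exists (fun b b' => g (b, b')); split=> [b b'|x x' /eqP xx']; first by case: (gP (b, b')).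
have [|N [BN Nx] Nx'] := Bb x (~` [set x']).
  apply: open_nbhs_nbhs; split=> //; apply: closed_openC.
  exact/accessible_closed_set1/hausdorff_accessible.
have [|M xM MN] := @compact_regular X x setT hX cX filterT N.
  exact: (open_nbhs_nbhs (conj (Bo _ BN) Nx)).
have [U [BU Ux] UM] := Bb x M xM.
exists (SigSub (mem_set BU)), (SigSub (mem_set BN)).
have [_ /= gUN] := gP (SigSub (mem_set BU), SigSub (mem_set BN)).
have [||g0 g3] := gUN; first exact: Bo.
  exact: subset_trans (closureS UM) MN.
split; [exact: g0|apply: g3 => Nx'x; exact: (Nx' _ Nx'x erefl)].
Qed.

(** * Assembling the hereditarily indecomposable continuum over [X] *)

Lemma hereditarily_indecomposable_cover (R : realType) (X : topologicalType) :
  continuum X ->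
  exists (Y : topologicalType) (f : Y -> X),
    [/\ continuum Y, hereditarily_indecomposable Y, covering_dim_eq Y 1,
        same_weight Y X & weakly_confluent f].
Proof.
move=> [hX cX coX X0]; have [B0 bB0 B0min] := exists_min_basis X.
have [g [cg gsep]] := urysohn_family_separates R hX cX bB0.
have sX : subcontinuum [set: X] by split.
have [Y [sY YD YK Yfree]] := terms_continuum cg hX sX.
have hV := @hausdorff_ptws R nat (@Rhausdorff R).
have hW := hausdorff_pair hX (@hausdorff_ptws _ (term (B := B0)) hV).
pose inc (y : Y) := set_val y.
have cinc : continuous inc := @set_val_continuous _ Y.
have incinj : injective inc := @set_val_injective _ Y.
have hY := subtype_hausdorff hW (Y := Y).
have [[cY coY Y0] _] := subtype_subcontinuum hW (@subset_refl _ Y) sY.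
have YT : set_val @^-1` Y = [set: Y].
  by apply/seteqP; split=> // y _; exact: set_valP.
rewrite YT in cY coY Y0.
pose f (y : Y) := (inc y).1.
have cf : continuous f := comp_continuous cinc (@fst_continuous _ _).
have wf K : subcontinuum K -> exists2 L : set Y, subcontinuum L & f @` L = K.
  move=> sK; have [L [sL LY LK]] := YK K sK.
  have [sL' imL] := subtype_subcontinuum hW LY sL.
  exists (set_val @^-1` L) => //.
  by rewrite -LK -[in RHS]imL image_comp.
have fsurj : f @` [set: Y] = [set: X].
  have [L _ LX] := wf _ sX; apply/seteqP; split=> // x _.
  have [y _ yx] : (f @` L) x by rewrite LX.
  by exists y.
have jD (y : Y) t : t != free_term -> demand g t (inc y, (inc y).2 t).
  by move=> tf; apply: YD => //; exact: set_valY.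
(* The free coordinate takes the values 0 and 1, so [Y] has two points even when [X] is a single
   point. *)
have [p [q pq]] : exists p q : Y, p <> q.
  have [y0 Yy0 y0E] := Yfree 0 (introT andP (conj (lexx _) ler01)).
  have [y1 Yy1 y1E] := Yfree 1 (introT andP (conj ler01 (lexx _))).
  exists (SigSub (mem_set Yy0)), (SigSub (mem_set Yy1)) => -[y01].
  have := congr1 (fun w : nat -> R => w 0%N) (y0E).
  rewrite y01 y1E => /eqP.
  by rewrite /const_seq oner_eq0.
exists Y, f; split.
- by split.
- exact: (model_hereditarily_indecomposable gsep hY cY cinc incinj jD).
- split; first exact: (model_dim_le1 gsep cY cinc incinj jD).
  by case=> // _; exact: connected_dim_neq0 hY coY pq.
- split.
  (* The base of [Y] is indexed by the terms over the minimal base [B0], of which there are at most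
     max(|B0|, aleph_0). *)
  + exists (range (fun t => [set y | 0 < level inc t y])).
      exact: (level_basis gsep cY cinc incinj jD).
    move=> BX bBX; have [x _] := X0.
    have [U [BU _] _] := bB0.2 x setT filterT.
    have B0X : [set: B0] #<= BX.
      apply: card_le_trans (B0min _ bBX).
      by have /card_eqPle[] := card_setT B0.
    have [c|c] := card_term (SigSub (mem_set BU) : B0); [left|right].
    * exact: card_le_trans (card_image_le _ _) (card_le_trans c B0X).
    * exact: card_le_trans (card_image_le _ _) c.
  + exists B0 => // BY bBY; exact: compact_image_basis_le hX cY cf fsurj bBY B0min.
- by split.
Qed.

Theorem theorem4p4 (X : topologicalType) :
  continuum X ->
  exists (Y : topologicalType) (f : Y -> X),
    [/\ continuum Y, hereditarily_indecomposable Y, covering_dim_eq Y 1,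
        same_weight Y X & weakly_confluent f].
Proof. exact: (@hereditarily_indecomposable_cover Rdefinitions.R). Qed.
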